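(* Let $r,d\ge 2$ be integers and let $p\ge 1$ be a real number. Let $S_{r,d}=F/F^{(d)}$ be the free solvable group of rank $r$ and derived length $d$. Then the $L^p$ compression exponent $\alpha^\star_p(S_{r,d})$ satisfies $$\frac{1}{d-1}\max\left\{\frac{1}{p},\frac{1}{2}\right\}\ \le\ \alpha^\star_p(S_{r,d}).$$
   Context: $F$ is the free group of rank $r$ and $F^{(d)}$ its $d$-th derived subgroup ($F^{(0)}=F$, $F^{(k+1)}=[F^{(k)},F^{(k)}]$). For a finitely generated group $G$ with a word metric $d_G$ (from a finite generating set), the $L^p$ compression exponent $\alpha_p^\star(G)$ is the supremum of all $\alpha\ge 0$ for which there exist a Lipschitz map $f:G\to L^p$ and a constant $C>0$ such that $C\,d_G(g_1,g_2)^\alpha\le\|f(g_1)-f(g_2)\|$ for all $g_1,g_2\in G$. Here $L^p$ is the standard Lebesgue space, e.g. $L^p([0,1])$, with its norm. *)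

(* Defs.v *)
From HB Require Import structures.
From mathcomp Require Import all_boot all_order all_algebra.
From mathcomp Require Import all_classical all_reals all_analysis.

Set Implicit Arguments.
Unset Strict Implicit.
Unset Printing Implicit Defensive.

Import Order.TTheory GRing.Theory Num.Theory.

Local Open Scope classical_set_scope.
Local Open Scope quotient_scope.

Section Subgroups.
Variable G : groupType.
Implicit Types (A H : set G) (x y : G).
Local Open Scope group_scope.

Definition is_subgroup H : Prop := group_closed (mem H).

Definition subgroup_generated A : set G := smallest is_subgroup A.

Fixpoint derived_series n : set G :=
  if n is k.+1 then
    subgroup_generated
      [set [~ x, y] | x in derived_series k & y in derived_series k]
  else setT.

Definition is_normal H : Prop := forall x y, H x -> H (x ^ y).

Lemma is_subgroupP H :
  is_subgroup H <-> H 1 /\ (forall x y, H x -> H y -> H (x / y)).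
Proof.
split=> -[H1 HB]; split.
- by rewrite inE in H1.
- by move=> x y Hx Hy; apply: set_mem; apply: (HB x y); apply: mem_set.
- by rewrite inE.
- by move=> x y /set_mem Hx /set_mem Hy; apply/mem_set/HB.
Qed.

Lemma subgroup_generatedP A : is_subgroup (subgroup_generated A).
Proof.
apply/is_subgroupP; split=> [H [/is_subgroupP[H1 _] _]//|x y sx sy H HA].
have [/is_subgroupP[_ HB] _] := HA.
by apply: HB; [apply: sx | apply: sy].
Qed.

Lemma derived_series_subgroup n : is_subgroup (derived_series n).
Proof.
case: n => [|n]; last exact: subgroup_generatedP.
by apply/is_subgroupP.
Qed.

Lemma derived_series_normal n : is_normal (derived_series n).
Proof.
elim: n => [//|n IHn] x y sx.
suff: derived_series n.+1 `<=` [set z | derived_series n.+1 (z ^ y)] by apply.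
apply: smallest_sub.
  have /is_subgroupP[D1 DB] := derived_series_subgroup n.+1.
  apply/is_subgroupP; split=> [|u v Du Dv]; first by rewrite /mkset conj1g.
  by rewrite /mkset conjMg conjVg; apply: DB.
move=> _ [u Du [v Dv <-]]; rewrite /mkset conjRg.
by apply: sub_gen_smallest; exists (u ^ y); [apply: IHn | exists (v ^ y); [apply: IHn|]].
Qed.

Record normal_subgroup := NormalSubgroup {
  nsubgroup_set :> G -> Prop;
  nsubgroup_closed : is_subgroup nsubgroup_set;
  nsubgroup_normal : is_normal nsubgroup_set
}.

Definition derived_nsubgroup n : normal_subgroup :=
  NormalSubgroup (derived_series_subgroup n) (@derived_series_normal n).

End Subgroups.

Section Quotient.
Variables (G : groupType) (N : normal_subgroup G).
Implicit Types x y : G.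
Local Open Scope group_scope.

Definition coset_rel x y := `[< N (x^-1 * y) >].

Let N1 : N 1. Proof. by have /is_subgroupP[] := nsubgroup_closed N. Qed.

Let NF x y : N x -> N y -> N (x / y).
Proof. by have /is_subgroupP[_] := nsubgroup_closed N; apply. Qed.

Let NV x : N x -> N x^-1.
Proof. by move=> Nx; rewrite -[x^-1]mul1g; exact: NF. Qed.

Let NM x y : N x -> N y -> N (x * y).
Proof. by move=> Nx Ny; rewrite -[y]invgK; apply/NF/NV. Qed.

Let NJ x y : N x -> N (x ^ y).
Proof. exact: nsubgroup_normal. Qed.

Let coset_rel_refl : reflexive coset_rel.
Proof. by move=> x; apply/asboolP; rewrite mulVg. Qed.

Let coset_rel_sym : symmetric coset_rel.
Proof.
by move=> x y; apply/asboolP/asboolP => /NV; rewrite invgM invgK.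
Qed.

Let coset_rel_trans : transitive coset_rel.
Proof.
move=> y x z /asboolP xy /asboolP yz; apply/asboolP.
by rewrite -[z](mulVKg y) mulgA; rewrite mulgA -[_ * y^-1 * z]mulgA; apply: NM.
Qed.

Canonical coset_equiv :=
  EquivRel coset_rel coset_rel_refl coset_rel_sym coset_rel_trans.

Definition quotient_group : Type := {eq_quot coset_rel}.
HB.instance Definition _ := Choice.on quotient_group.
HB.instance Definition _ := EqQuotient.on quotient_group.

Local Notation Q := quotient_group.

Definition quot_one : Q := \pi_Q 1.
Definition quot_inv (a : Q) : Q := \pi_Q (repr a)^-1.
Definition quot_mul (a b : Q) : Q := \pi_Q (repr a * repr b).

Let coset_repr x : N (x^-1 * repr (\pi_Q x)).
Proof. by apply/asboolP; rewrite -[`[<_>]]/(coset_rel x _) -eqmodE reprK. Qed.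

Let eq_pi x y : N (x^-1 * y) -> \pi_Q x = \pi_Q y.
Proof. by move=> xy; apply/eqmodP/asboolP. Qed.

Lemma quot_piM x y : quot_mul (\pi_Q x) (\pi_Q y) = \pi_Q (x * y).
Proof.
apply/esym/eq_pi; set x' := repr _; set y' := repr _.
have -> : (x * y)^-1 * (x' * y') = (x^-1 * x') ^ y * (y^-1 * y').
  by rewrite conjgE invgM !mulgA mulgK.
by apply: NM; [apply: NJ|]; apply: coset_repr.
Qed.

Lemma quot_piV x : quot_inv (\pi_Q x) = \pi_Q x^-1.
Proof.
apply/esym/eq_pi; set x' := repr _; rewrite invgK.
have -> : x / x' = ((x^-1 * x')^-1) ^ x^-1.
  by rewrite conjgE invgM !invgK !mulgA mulgK.
by apply/NJ/NV/coset_repr.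
Qed.

Let quot_mulA : associative quot_mul.
Proof.
by move=> a b c; rewrite -[a]reprK -[b]reprK -[c]reprK !quot_piM !reprK mulgA.
Qed.

Let quot_mul1 : left_id quot_one quot_mul.
Proof. by move=> a; rewrite -[a]reprK quot_piM mul1g. Qed.

Let quot_mulr1 : right_id quot_one quot_mul.
Proof. by move=> a; rewrite -[a]reprK quot_piM mulg1. Qed.

Let quot_mulV : left_inverse quot_one quot_inv quot_mul.
Proof. by move=> a; rewrite -[a]reprK quot_piV quot_piM mulVg. Qed.

Let quot_mulrV : right_inverse quot_one quot_inv quot_mul.
Proof. by move=> a; rewrite -[a]reprK quot_piV quot_piM mulgV. Qed.

HB.instance Definition _ := isGroup.Build quotient_group
  quot_mulA quot_mul1 quot_mulr1 quot_mulV quot_mulrV.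

End Quotient.

Section FreeGroup.
Variable X : choiceType.

(* The letter (x, false) stands for the generator x and (x, true) for its
   inverse. *)
Definition letter : Type := (X * bool)%type.
HB.instance Definition _ := Choice.on letter.
Implicit Types (a b : letter) (s t u : seq letter).

Definition letter_inv a : letter := (a.1, ~~ a.2).

Definition reduced s := sorted (fun a b => b != letter_inv a) s.

Definition push a s :=
  if s is b :: t then if b == letter_inv a then t else a :: s else [:: a].

Definition reduce s := foldr push [::] s.

Lemma letter_invK : involutive letter_inv.
Proof. by case=> x e; rewrite /letter_inv /= negbK. Qed.

Lemma reduced_behead a s : reduced (a :: s) -> reduced s.
Proof. by case: s => [//|b s] /= /andP[]. Qed.

Lemma push_reduced a s : reduced s -> reduced (push a s).
Proof.
case: s => [//|b s] rs /=; case: eqP => [_|/eqP nb].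
  exact: reduced_behead rs.
by rewrite /reduced /= nb.
Qed.

Lemma foldr_push_reduced s t : reduced t -> reduced (foldr push t s).
Proof. by move=> rt; elim: s => //= a s IHs; exact: push_reduced. Qed.

Lemma reduce_reduced s : reduced (reduce s).
Proof. exact: foldr_push_reduced. Qed.

Lemma reduce_id s : reduced s -> reduce s = s.
Proof.
elim: s => //= a s IHs rs; rewrite -/(reduce s) IHs; last exact: reduced_behead rs.
by case: s rs {IHs} => [//|b s] /andP[/negbTE /= ->].
Qed.

Lemma pushK a s : reduced s -> push (letter_inv a) (push a s) = s.
Proof.
case: s => [|b s] rs /=; first by rewrite letter_invK eqxx.
case: eqP => [eb|_] /=; last by rewrite letter_invK eqxx.
case: s rs => [_|c s /andP[/negbTE /= nc _]] /=; first by rewrite eb.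
by rewrite -{1}eb nc eb.
Qed.

Lemma foldr_push s t : reduced t -> foldr push t s = foldr push t (reduce s).
Proof.
move=> rt; elim: s => //= a s ->; rewrite -/(reduce s).
move: (reduce_reduced s); case: (reduce s) => [//|b u] ru /=.
case: eqP => //= ->.
by rewrite -{1}[a]letter_invK pushK //; exact: foldr_push_reduced.
Qed.

Lemma reduce_cat s t : reduce (s ++ t) = reduce (reduce s ++ reduce t).
Proof.
rewrite /reduce !foldr_cat -/(reduce _) -/(reduce _).
rewrite [in RHS](reduce_id (reduce_reduced t)).
by apply: foldr_push; exact: reduce_reduced.
Qed.

Definition word_inv s := rev (map letter_inv s).

Lemma reduce_invl s : reduce (word_inv s ++ s) = [::].
Proof.
suff H t : reduced t -> foldr push (foldr push t s) (word_inv s) = t.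
  by rewrite /reduce foldr_cat H.
elim: s t => [//|a s IHs] t rt; rewrite /word_inv /= rev_cons -cats1 foldr_cat /=.
by rewrite pushK ?IHs //; exact: foldr_push_reduced.
Qed.

Lemma word_invK : involutive word_inv.
Proof.
move=> s; rewrite /word_inv map_rev revK -map_comp -[RHS]map_id.
by apply: eq_map => a; exact: letter_invK.
Qed.

Lemma reduce_invr s : reduce (s ++ word_inv s) = [::].
Proof. by rewrite -{1}[s]word_invK reduce_invl. Qed.

Record free_group : Type := FreeGroup {
  free_word :> seq letter;
  free_word_reduced : reduced free_word
}.
HB.instance Definition _ := [isSub for free_word].
HB.instance Definition _ := [Choice of free_group by <:].

Definition fg_of_word s : free_group := FreeGroup (reduce_reduced s).
Definition fg_one : free_group := fg_of_word [::].
Definition fg_mul (u v : free_group) : free_group := fg_of_word (u ++ v).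
Definition fg_inv (u : free_group) : free_group := fg_of_word (word_inv u).

Let fg_mulA : associative fg_mul.
Proof.
case=> u ru [v rv] [w rw]; apply: val_inj => /=.
rewrite -[in LHS](reduce_id ru) -[in RHS](reduce_id rw).
by rewrite -!reduce_cat catA.
Qed.

Let fg_mul1 : left_id fg_one fg_mul.
Proof. by case=> u ru; apply: val_inj; exact: reduce_id. Qed.

Let fg_mulr1 : right_id fg_one fg_mul.
Proof. by case=> u ru; apply: val_inj; rewrite /= cats0; exact: reduce_id. Qed.

Let fg_mulV : left_inverse fg_one fg_inv fg_mul.
Proof.
case=> u ru; apply: val_inj => /=.
by rewrite -[X in _ ++ X](reduce_id ru) -reduce_cat reduce_invl.
Qed.

Let fg_mulrV : right_inverse fg_one fg_inv fg_mul.
Proof.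
case=> u ru; apply: val_inj => /=.
by rewrite -[X in X ++ _](reduce_id ru) -reduce_cat reduce_invr.
Qed.

HB.instance Definition _ := isGroup.Build free_group
  fg_mulA fg_mul1 fg_mulr1 fg_mulV fg_mulrV.

End FreeGroup.

Definition free_solvable (r d : nat) : groupType :=
  quotient_group (derived_nsubgroup (free_group 'I_r) d).

Section WordLength.
Variables (G : groupType) (S : seq G).
Local Open Scope group_scope.

Definition generates : Prop := subgroup_generated [set` S] = setT.

Definition expressible (g : G) (n : nat) : Prop :=
  exists w : seq G, [/\ size w = n,
    {in w, forall s, (s \in S) || (s^-1 \in S)} & \prod_(s <- w) s = g].

(* The least length of a word representing g; an arbitrary value when g is not
   in the subgroup generated by S. *)
Definition word_length (g : G) : nat :=
  [get n | expressible g n /\ forall m, expressible g m -> (n <= m)%N].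

Definition word_dist (g h : G) : nat := word_length (g^-1 * h).

End WordLength.

Section Compression.
Variable R : realType.
Local Open Scope ring_scope.

Definition lebesgue01 : {measure set (measurableTypeR R) -> \bar R} :=
  mrestr lebesgue_measure (measurable_itv `[0%R : R, 1%R]).

Variables (p : R) (p1 : 1 <= p).

Definition Lp01 : Type := LspaceType lebesgue01 (p1 : (1 <= p%:E)%E).

(* Elements of Lp01 are almost-everywhere classes; the coercion to functions
   picks a representative, on which the norm does not depend. *)
Definition Lp_dist (u v : Lp01) : \bar R :=
  'N[lebesgue01]_p%:E [EFin \o ((u : R -> R) \- (v : R -> R))].

Variables (G : groupType) (S : seq G).

Definition is_lipschitz (f : G -> Lp01) : Prop :=
  exists L : R, forall g h,
    (Lp_dist (f g) (f h) <= (L * (word_dist S g h)%:R)%:E)%E.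

(* Both sides of the inequality vanish for g = h when 0 < alpha; the case g = h
   is left out because 0 `^ 0 = 1 would make alpha = 0 fail for every f. *)
Definition compresses (alpha : R) (f : G -> Lp01) : Prop :=
  exists2 C : R, 0 < C & forall g h, g <> h ->
    ((C * (word_dist S g h)%:R `^ alpha)%:E <= Lp_dist (f g) (f h))%E.

(* The supremum is extended-real because the exponents are unbounded when G is
   finite. *)
Definition Lp_compression_exponent : \bar R :=
  ereal_sup [set alpha%:E | alpha in [set alpha : R | 0 <= alpha /\
    exists f : G -> Lp01, is_lipschitz f /\ compresses alpha f]].

End Compression.

(* Main.v *)
Require Import Defs.
From HB Require Import structures.
From mathcomp Require Import all_boot all_order all_algebra.
From mathcomp Require Import finmap.
From mathcomp Require Import all_classical all_reals all_analysis.
From mathcomp Require Import measurable_realfun.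
From mathcomp Require Import zify ring lra.

Set Implicit Arguments.
Unset Strict Implicit.
Unset Printing Implicit Defensive.

Import Order.TTheory GRing.Theory Num.Theory.
Import numFieldNormedType.Exports.

Local Open Scope quotient_scope.
Local Open Scope ring_scope.

(** Write N for a term of the derived series of the free group F, so that F/N is
    a free solvable group and F/[N,N] is the next one.

    Walls. A lower bound for the compression exponent follows from a
    combinatorial structure, [has_walls N q alpha]: every element of F/N gets a
    finite set of weighted walls, a generator changes walls of bounded total
    weight, and two elements at distance n differ in walls whose weights to the
    power q add up to at least c n^alpha. With q = min(p, 2) there are functions
    e_0, e_1, ... on [0, 1] such that the Lp norm of a combination of them is at
    most the l1 norm of its coefficients and at least a constant times their lq
    norm: normalised disjoint bumps if p <= 2 ([bump_system]), cosines if p > 2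
    ([wave_system]). Sending an element to the weighted sum of the functions of
    its walls gives compression alpha / q ([walls_compression]), and 1 / q is
    the maximum of 1 / p and 1 / 2. It remains to find walls for the free
    solvable group of derived length d with alpha arbitrarily close to
    1 / (d - 1).

    Geometry of F/[N,N]. A word draws a path in the Cayley graph of F/N, and its
    flow counts the signed passages through each edge. The image of the word in
    F/[N,N] is determined by its flow and its endpoint ([flow_inj], which is the
    injectivity of the Magnus embedding). Conversely, two elements whose flows
    differ by a total amount n are joined by a word of length at most n plus
    twice the length of any path that visits the edges where the flows differ
    ([tour_route]): the difference is decomposed greedily into trails, which are
    inserted along that path. So F/[N,N] behaves like a lamplighter group over
    F/N, the flow being the configuration of the lamps.

    Lifting walls. Take pairs of disjoint subsets C and Q of F/N. While the
    lamplighter stands in C, it records the restriction of the flow to Q as a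
    wall ([view_walls]). A step changes the flow only next to the lamplighter,
    so it affects this record only when the lamplighter enters or leaves C. Two
    elements with cursors in C are distinguished as soon as their flows differ
    somewhere on Q ([lamp_ge]). To these walls one adds the l1 distance of the
    flows and the walls of F/N at the cursor.

    Induction. If C and Q are the two sides of a wall of F/N, then the new walls
    have weight at least n + D^alpha, up to a constant, where D is the distance
    from the cursor to the farthest place where the flows differ. The distance
    is at most a constant times n (1 + D), so alpha becomes alpha / (1 + alpha),
    and 1 / k becomes 1 / (k + 1) ([walls_step]).

    Derived length 2. This step would only give 1 / 2 over the free abelian
    group F/[F,F], while every alpha < 1 is needed. There, Q runs over the cells
    of the cubic grids of side 3^i, and C over the points at distance more than
    c from Q, for 3^i thresholds c; walls of scale i have a weight that decays
    geometrically in i, so that all the scales can be used together. A tour that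
    inserts the points one at a time, each as a detour from the nearest point
    visited so far, has the property that points with long detours of
    comparable lengths are far from each other, hence in different cells, and
    each of them is paid for by its own walls ([walls_grid]). *)

(** * Words and flows on the Cayley graph of a quotient *)

Section Words.
Variables (X : choiceType) (N : normal_subgroup (free_group X)).
Local Notation H := (quotient_group N).
Local Notation word := (seq (letter X)).
Implicit Types (u v w : word) (h k : H) (a : letter X).

Definition cls w : H := \pi_H (fg_of_word w).

Lemma nsub1 : N 1%g.
Proof. by have /is_subgroupP[] := nsubgroup_closed N. Qed.

Lemma nsubF x y : N x -> N y -> N (x / y)%g.
Proof. by have /is_subgroupP[_] := nsubgroup_closed N; apply. Qed.

Lemma fg_word_cat u v : fg_of_word (u ++ v) = (fg_of_word u * fg_of_word v)%g.
Proof. by apply: val_inj; rewrite /= reduce_cat. Qed.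

Lemma fg_word_val (x : free_group X) : fg_of_word x = x.
Proof. by apply: val_inj; rewrite /= reduce_id //; case: x. Qed.

Lemma cls_reduce u : cls (reduce u) = cls u.
Proof. by rewrite /cls -[reduce u]/(fg_of_word u : word) fg_word_val. Qed.

Lemma fg_word_inv u : fg_of_word (word_inv u) = (fg_of_word u)^-1%g.
Proof.
apply/esym/mulg1_eq; rewrite -fg_word_cat; apply: val_inj => /=.
by rewrite reduce_invr.
Qed.

Lemma quot_pi_mul (x y : free_group X) : \pi_H (x * y)%g = (\pi_H x * \pi_H y)%g.
Proof. exact: esym (quot_piM _ _ _). Qed.

Lemma cls_cat u v : cls (u ++ v) = (cls u * cls v)%g.
Proof. by rewrite /cls fg_word_cat quot_pi_mul. Qed.

Lemma cls_nil : cls [::] = 1%g. Proof. by []. Qed.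

Lemma cls_cons a w : cls (a :: w) = (cls [:: a] * cls w)%g.
Proof. by rewrite -cls_cat. Qed.

Lemma cls_inv w : cls (word_inv w) = (cls w)^-1%g.
Proof.
apply/esym/mulg1_eq; rewrite -cls_cat /cls -cls_nil /cls; congr (\pi_H _).
by apply: val_inj; rewrite /= reduce_invr.
Qed.

Lemma cls_letter_inv a : cls [:: letter_inv a] = (cls [:: a])^-1%g.
Proof. by rewrite -cls_inv. Qed.

Definition word_of h : word := repr h.

Lemma word_ofK h : cls (word_of h) = h.
Proof. by rewrite /cls fg_word_val reprK. Qed.

Lemma cls_eqP u v : cls u = cls v <-> N ((fg_of_word u)^-1 * fg_of_word v)%g.
Proof.
split=> [/eqmodP/asboolP //|uv].
by apply/eqmodP/asboolP.
Qed.

Lemma cls_eq1P u : cls u = 1%g <-> N (fg_of_word u).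
Proof.
rewrite -cls_nil; split => [/esym/cls_eqP|Nu].
  have -> : fg_of_word [::] = 1%g :> free_group X by [].
  by rewrite invg1 mul1g.
apply/esym/cls_eqP.
have -> : fg_of_word [::] = 1%g :> free_group X by [].
by rewrite invg1 mul1g.
Qed.

(** The edge [(h, s)] joins [h] to [h s]. The letters [(s, false)] and [(s, true)]
    traverse it forwards and backwards. *)
Definition edge : Type := (H * X)%type.
HB.instance Definition _ := Choice.on edge.

Definition edge_of h a : edge := (if a.2 then (h * cls [:: a])%g else h, a.1).

Fixpoint path_edges h w : seq (edge * bool) :=
  if w is a :: v then (edge_of h a, a.2) :: path_edges (h * cls [:: a])%g v
  else [::].

Definition flow h w (e : edge) : int :=
  (count_mem (e, false) (path_edges h w))%:Z
  - (count_mem (e, true) (path_edges h w))%:Z.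

Lemma path_edges_cat h u v :
  path_edges h (u ++ v) = path_edges h u ++ path_edges (h * cls u)%g v.
Proof.
elim: u h => [|a u IH] h /=; first by rewrite cls_nil mulg1.
by rewrite IH (cls_cons a u) mulgA.
Qed.

Lemma flow_nil h e : flow h [::] e = 0. Proof. by []. Qed.

Lemma flow_cat h u v e : flow h (u ++ v) e = flow h u e + flow (h * cls u)%g v e.
Proof. by rewrite /flow path_edges_cat !count_cat; lia. Qed.

Lemma flow_letter h a e :
  flow h [:: a] e = if e == edge_of h a then (-1) ^+ a.2 else 0.
Proof.
rewrite /flow /= !addn0 !xpair_eqE (eq_sym e).
by case: (edge_of h a == e); case: a.2.
Qed.

Lemma flow_cons h a w e :
  flow h (a :: w) e = flow h [:: a] e + flow (h * cls [:: a])%g w e.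
Proof. by rewrite -cat1s flow_cat. Qed.

Lemma edge_of_inv h a : edge_of (h * cls [:: a])%g (letter_inv a) = edge_of h a.
Proof.
case: a => s [] //; rewrite /edge_of cls_letter_inv mulgK //.
Qed.

Lemma flow_letter_inv h a e :
  flow (h * cls [:: a])%g [:: letter_inv a] e = - flow h [:: a] e.
Proof.
rewrite !flow_letter edge_of_inv; case: (e == _); rewrite ?oppr0 //=.
by case: a.2.
Qed.

Lemma flow_push h a w e : flow h (push a w) e = flow h (a :: w) e.
Proof.
case: w => [//|b w] /=; case: eqP => [->|//].
rewrite flow_cons (flow_cons _ (letter_inv a)) flow_letter_inv addrA subrr add0r.
by rewrite cls_letter_inv mulgK.
Qed.

Lemma flow_reduce h w e : flow h (reduce w) e = flow h w e.
Proof.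
elim: w h => [//|a w IH] h.
by rewrite /= -/(reduce w) flow_push flow_cons IH -flow_cons.
Qed.

Lemma flow_inv h w e : flow (h * cls w)%g (word_inv w) e = - flow h w e.
Proof.
apply/eqP; rewrite -addr_eq0 addrC -flow_cat -flow_reduce reduce_invr.
by rewrite flow_nil.
Qed.

End Words.

(** * Injectivity of the Magnus embedding *)

(** The head of the list is cancelled against an occurrence of its inverse, which
    exists because the two multiplicities agree. *)
Lemma prod_cancel (T : eqType) (G : groupType) (g : T -> G) (l : seq (T * bool)) :
  (forall x y, commute (g x) (g y)) ->
  (forall x, count_mem (x, false) l = count_mem (x, true) l) ->
  (\prod_(xb <- l) (if xb.2 then (g xb.1)^-1 else g xb.1) = 1)%g.
Proof.
move=> gC; pose q (xb : T * bool) := (if xb.2 then (g xb.1)^-1 else g xb.1)%g.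
have qC xb yc : commute (q xb) (q yc).
  have C1 z : commute (g z) (q yc) by rewrite /q; case: ifP => _ //; exact: commuteV.
  rewrite /q; case: ifP => _; last exact: C1.
  by apply: commute_sym; apply: commuteV; apply: commute_sym; exact: C1.
have [n] := ubnP (size l); elim: n l => // n IH [|[x b] l] ln lC.
  by rewrite big_nil.
have xl : (x, ~~ b) \in l.
  rewrite -has_pred1 has_count; move: (lC x); rewrite /= !xpair_eqE eqxx /=.
  by case: (b) => /=; rewrite add0n add1n => E0; [rewrite E0|rewrite -E0].
case/path.splitPr: xl ln lC => l1 l2 ln lC.
rewrite big_cons big_cat big_cons /=.
pose P1 := (\prod_(i <- l1) q i)%g; pose P2 := (\prod_(i <- l2) q i)%g.
change (q (x, b) * (P1 * (q (x, ~~ b) * P2)) = 1)%g.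
have CP : commute (q (x, ~~ b)) P1 by apply: commute_prod => i _; exact: qC.
have -> : (q (x, b) * (P1 * (q (x, ~~ b) * P2)) = P1 * P2)%g.
  rewrite (mulgA P1) -CP -(mulgA _ P1) (mulgA (q (x, b))).
  have -> : (q (x, b) * q (x, ~~ b) = 1)%g.
    by rewrite /q /=; case: (b); rewrite /= ?mulgV ?mulVg.
  by rewrite mul1g.
rewrite -[LHS](big_cat _ (l1) l2).
apply: IH; first by move: ln; rewrite /= !size_cat /=; lia.
move=> y; move: (lC y); rewrite /= !count_cat /= !xpair_eqE.
case: (x == y); case: (b) => /= E0; lia.
Qed.

Section Magnus.
Variables (X : choiceType) (N M : normal_subgroup (free_group X)).
Hypothesis NM : M = subgroup_generated
  [set [~ x, y]%g | x in (N : set _) & y in (N : set _)]%classic :> set _.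
Local Notation word := (seq (letter X)).
Implicit Types (u v w : word).

(** An element of [N] draws a closed path from every base point. Hence the flow is
    additive on [N], with values in an abelian group, and vanishes on commutators. *)
Lemma flow_derived h (x : free_group X) : M x ->
  N x /\ forall e : edge N, flow h x e = 0.
Proof.
pose D : set (free_group X) :=
  [set x | N x /\ forall h (e : edge N), flow h x e = 0]%classic.
suff MD : (M `<=` D)%classic by move=> /MD[? ?]; split.
have flowM (y z : free_group X) h' e : flow (N:=N) h' (y * z)%g e =
   flow h' y e + flow (h' * cls N y)%g z e.
  by rewrite -flow_cat -[LHS]/(flow _ (reduce _) _) flow_reduce.
have flowV (y : free_group X) h' e : flow (N:=N) (h' * cls N y)%g (y^-1)%g e = - flow h' y e.
  by rewrite -[LHS]/(flow _ (reduce _) _) flow_reduce flow_inv.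
have cls1 (y : free_group X) : N y -> cls N y = 1%g.
  by move=> Ny; apply/cls_eq1P; rewrite fg_word_val.
have NV (y : free_group X) : N y -> N (y^-1)%g.
  move=> Ny; rewrite -div1g; apply: nsubF => //; exact: nsub1.
have flowV' (y : free_group X) h' e : N y -> flow (N:=N) h' (y^-1)%g e = - flow h' y e.
  by move=> Ny; rewrite -flowV cls1 ?mulg1.
rewrite NM; apply: smallest_sub.
  apply/is_subgroupP; split.
    by split=> [|h' e]; [exact: nsub1|].
  move=> y z [Ny y0] [Nz z0]; split; first exact: nsubF.
  by move=> h' e; rewrite flowM y0 flowV' // z0 oppr0 addr0.
move=> _ [y Ny [z Nz <-]]; split.
  rewrite commgEl -[(y ^ z)%g]invgK; apply: nsubF; first exact: NV.
  by rewrite -conjVg; apply: nsubgroup_normal; exact: NV.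
have NyV := NV _ Ny; have NzV := NV _ Nz.
by move=> h1 e; rewrite commgEl conjgE !flowM !flowV' // !cls1 // !mulg1; lia.
Qed.

(** So endpoint and flow are functions on F/[N,N]. *)
Lemma flow_cls u v : cls M u = cls M v ->
  cls N u = cls N v /\ forall h e, flow (N:=N) h u e = flow h v e.
Proof.
move=> /cls_eqP uv.
have vE : v = v by [].
have Nuv : N ((fg_of_word u)^-1 * fg_of_word v)%g by have [] := flow_derived 1%g uv.
split=> [|h e]; first exact/cls_eqP.
have /= [_ /(_ e)] := flow_derived (h * cls N (reduce u))%g uv.
rewrite flow_reduce flow_cat !flow_reduce flow_inv flow_reduce.
by rewrite !cls_reduce cls_inv cls_reduce mulgK => /eqP; rewrite addrC subr_eq0 => /eqP.
Qed.

(** The loop through an edge: along the chosen representative of [h], across the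
    letter [a], and back along the representative of the endpoint. These are the
    Schreier generators of [N]. *)
Definition edge_loop h (a : letter X) : quotient_group M :=
  (cls M (word_of h) * cls M [:: a] * (cls M (word_of (h * cls N [:: a])))^-1)%g.

(** The loops represent elements of [N], and [N] becomes abelian in F/[N,N]. *)
Lemma edge_loop_comm h a k b : commute (edge_loop h a) (edge_loop k b).
Proof.
have gN h' a' : exists2 w, edge_loop h' a' = cls M w & N (fg_of_word w).
  exists (word_of h' ++ [:: a'] ++ word_inv (word_of (h' * cls N [:: a'])%g)).
    by rewrite /edge_loop !cls_cat cls_inv mulgA.
  by apply/cls_eq1P; rewrite !cls_cat cls_inv !word_ofK mulgA mulgV.
have [u -> Nu] := gN h a; have [v -> Nv] := gN k b.
apply/commgP/eqP; transitivity (cls M (word_inv u ++ word_inv v ++ u ++ v)).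
  by rewrite !cls_cat !cls_inv.
apply/cls_eq1P; rewrite !fg_word_cat !fg_word_inv NM.
by apply: sub_gen_smallest; exists (fg_of_word u) => //; exists (fg_of_word v).
Qed.

(** Going back to the base point and forth again at each vertex of its path cuts
    a word into loops. *)
Lemma cls_edge_loops h w : (cls M (word_of h) * cls M w =
  (\prod_(eb <- path_edges h w) (if eb.2 then (edge_loop eb.1.1 (eb.1.2, false))^-1
      else edge_loop eb.1.1 (eb.1.2, false))) * cls M (word_of (h * cls N w)))%g.
Proof.
elim: w h => [|a w IH] h; first by rewrite big_nil cls_nil mulg1 mul1g mulg1.
rewrite /= big_cons (cls_cons M a w) (cls_cons N a w) (mulgA h) -[RHS]mulgA -IH.
rewrite !mulgA; congr (_ * _)%g.
rewrite /edge_of; case: a => s [] /=; rewrite /edge_loop /=; last by rewrite mulgVK.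
have -> : (s, true) = letter_inv (s, false) :> letter X by [].
rewrite !cls_letter_inv mulgVK !invgM invgK -!mulgA mulVg mulg1 //.
Qed.

(** The loop through an edge and its inverse occur with a difference of
    multiplicities equal to the flow on that edge, so all the loops cancel. *)
Lemma cls_eq1_flow0 w : cls N w = 1%g -> (forall e : edge N, flow 1%g w e = 0) -> cls M w = 1%g.
Proof.
move=> w1 f0; have := cls_edge_loops 1%g w; rewrite w1 mulg1.
rewrite (@prod_cancel _ _ (fun e => edge_loop e.1 (e.2, false))).
- by rewrite mul1g => /(canRL (mulKg _)); rewrite mulVg.
- by move=> x y; exact: edge_loop_comm.
- by move=> e; have /eqP := f0 e; rewrite subr_eq0 => /eqP [->].
Qed.

Lemma flow_inj u v : cls N u = cls N v ->
  (forall e : edge N, flow 1%g u e = flow 1%g v e) -> cls M u = cls M v.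
Proof.
move=> uv fuv; suff : cls M (u ++ word_inv v) = 1%g.
  by rewrite cls_cat cls_inv => /divg1_eq.
apply: cls_eq1_flow0 => [|e]; first by rewrite cls_cat cls_inv uv mulgV.
by rewrite flow_cat uv flow_inv fuv subrr.
Qed.

End Magnus.

(** * Realising flows by short words *)

Section Tours.
Variables (X : finType) (N : normal_subgroup (free_group X)).
Local Notation H := (quotient_group N).
Local Notation word := (seq (letter X)).
Implicit Types (u v w t : word) (h k : H) (a : letter X) (f : edge N -> int).

(** The letter [(s, true)] at [h] crosses the [s]-edge that enters [h], so this is
    the flow out of [h] minus the flow into [h]. *)
Definition divg f h : int :=
  \sum_s (f (edge_of h (s, false)) - f (edge_of h (s, true))).

Lemma divgB f g h : divg (fun e => f e - g e) h = divg f h - divg g h.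
Proof. by rewrite /divg -sumrB; apply: eq_bigr => s _; lia. Qed.

Lemma divg_letter h a k :
  divg (flow h [:: a]) k = (k == h)%:Z - (k == h * cls N [:: a])%g%:Z.
Proof.
rewrite /divg (bigD1 a.1) //= big1 ?addr0 => [|s /negbTE sa]; last first.
  by rewrite !flow_letter /edge_of /= !xpair_eqE !sa !andbF.
have cV s : cls N [:: (s, true)] = (cls N [:: (s, false)])^-1%g.
  exact: (cls_letter_inv N (s, false)).
rewrite !flow_letter /edge_of; case: a => s [] /=; rewrite !xpair_eqE !eqxx !andbT.
  rewrite (inj_eq (mulIg _)); by do 2 case: (k == _).
rewrite cV (can2_eq (mulgVK _) (mulgK _)); by do 2 case: (k == _).
Qed.

Lemma divg_flow h w k : divg (flow h w) k = (k == h)%:Z - (k == h * cls N w)%g%:Z.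
Proof.
elim: w h => [|a w IH] h.
  by rewrite cls_nil mulg1 subrr /divg big1 // => s _; rewrite !flow_nil.
have -> : divg (flow h (a :: w)) k =
    divg (flow h [:: a]) k + divg (flow (h * cls N [:: a])%g w) k.
  by rewrite /divg -big_split /=; apply: eq_bigr => s _; rewrite !(flow_cons _ _ w); lia.
by rewrite divg_letter IH (cls_cons N a w) mulgA addrA subrK.
Qed.

Variable E : seq (edge N).
Hypothesis uniqE : uniq E.

Definition mass f : nat := \sum_(e <- E) `|f e|%N.

(** Starting from [h], leave along any edge with flow in the direction of travel,
    removing one unit of it. Each step lowers the mass by one. By conservation the
    trail can get stuck only at [h'], and at that moment no edge at [h'] carries
    flow: none leads out, and the divergence is zero. *)
Lemma greedy_trail f h h' :
  (forall e, f e != 0 -> e \in E) ->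
  (forall k, divg f k = (k == h)%:Z - (k == h')%:Z) ->
  exists v f', [/\ (h * cls N v = h')%g, forall e, f e = flow h v e + f' e,
    (size v + mass f')%N = mass f, forall e, f' e != 0 -> f e != 0 &
    (forall k, divg f' k = 0) /\ forall a, f' (edge_of h' a) = 0].
Proof.
have [n] := ubnP (mass f); elim: n f h => // n IH f h lfn fE df.
have [/existsP[a fa]|/existsPn nout] :=
  boolP [exists a : letter X, 0 < (-1) ^+ a.2 * f (edge_of h a)].
- pose f1 e := f e - flow h [:: a] e.
  have f0 : f (edge_of h a) != 0 by apply: contraTneq fa => ->; rewrite mulr0.
  have f1f e : f1 e != 0 -> f e != 0.
    by have [->|/negbTE ne] := eqVneq e (edge_of h a); rewrite /f1 ?flow_letter ?ne ?subr0.
  have mf1 : mass f = (mass f1).+1.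
    rewrite /mass !(bigD1_seq (edge_of h a)) //=; try exact: fE.
    rewrite /f1 flow_letter eqxx -addSn; congr (_ + _)%N.
      by move: fa; case: (a.2) => /=; rewrite ?expr1 ?expr0; lia.
    by apply: eq_bigr => e /negbTE ne; rewrite flow_letter ne subr0.
  have [|||v [f' [hv ff' sv f'f1 [df' f'0]]]] := IH f1 (h * cls N [:: a])%g.
  + by move: lfn; rewrite mf1 ltnS.
  + by move=> e /f1f /fE.
  + by move=> k; rewrite divgB df divg_letter; ring.
  exists (a :: v), f'; split=> //.
  + by rewrite cls_cons mulgA.
  + by move=> e; rewrite flow_cons -addrA -ff' /f1 addrC subrK.
  + by rewrite /= addSn sv mf1.
  + by move=> e /f'f1 /f1f.
have tle s : 0 <= f (edge_of h (s, true)) by move: (nout (s, true)); rewrite /= expr1; lia.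
have fle s : f (edge_of h (s, false)) <= 0 by move: (nout (s, false)); rewrite /= expr0; lia.
have := df h; rewrite eqxx.
have dle : divg f h <= 0.
  by apply: sumr_le0 => s _; rewrite subr_le0 (le_trans (fle s)) ?tle.
case: eqP => [hh'|_]; last by move: dle; lia.
rewrite subrr => d0.
have all0 s : f (edge_of h (s, true)) = 0 /\ f (edge_of h (s, false)) = 0.
  have /eqP : - divg f h = 0 by rewrite d0 oppr0.
  rewrite -sumrN psumr_eq0 => [/allP /(_ s)|s' _]; last first.
    by rewrite oppr_ge0 subr_le0 (le_trans (fle s')) ?tle.
  rewrite mem_index_enum => /(_ isT) /eqP; move: (tle s) (fle s).
  by move: (f _) (f _) => x y; lia.
exists [::], f; split=> //.
- by rewrite cls_nil mulg1.
- by move=> e; rewrite flow_nil add0r.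
- split=> [k|]; first by rewrite df hh' subrr.
  by rewrite -hh' => -[s []]; have [] := all0 s.
Qed.

Fixpoint visits h t : seq H :=
  h :: (if t is a :: t' then visits (h * cls N [:: a])%g t' else [::]).

Lemma visits_cat h u v :
  visits h (u ++ v) = visits h u ++ behead (visits (h * cls N u)%g v).
Proof.
elim: u h => [|a u IH] h /=; first by rewrite cls_nil mulg1; case: v.
by rewrite IH (cls_cons N a u) mulgA.
Qed.

Lemma visits_head h t : h \in visits h t.
Proof. by case: t => [|a t]; rewrite /= inE eqxx. Qed.

Lemma visits_last h t : (h * cls N t)%g \in visits h t.
Proof.
elim: t h => [|a t IH] h /=; first by rewrite cls_nil mulg1 inE.
by rewrite inE cls_cons mulgA IH orbT.
Qed.

Lemma mem_visits_cat k h u v :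
  (k \in visits h (u ++ v)) = (k \in visits h u) || (k \in visits (h * cls N u)%g v).
Proof.
rewrite visits_cat mem_cat; case E0: (k \in visits h u) => //=.
have : k != (h * cls N u)%g by apply: contraFneq E0 => ->; exact: visits_last.
by case: v => [|a v] /=; rewrite !inE => /negbTE ->.
Qed.

(** Follow [t] and come back, inserting at each vertex on the way out a greedy
    closed trail. No flow is left at a vertex after its trail, so the rest of the
    circulation starts on the rest of [t]. The way back cancels the flow of [t]. *)
Lemma closed_tour t f h :
  (forall e, f e != 0 -> e \in E) -> (forall k, divg f k = 0) ->
  (forall e, f e != 0 -> e.1 \in visits h t) ->
  exists v, [/\ (h * cls N v = h)%g, forall e, f e = flow h v e &
    (size v <= 2 * size t + mass f)%N].
Proof.
elim: t h f => [|a t IH] h f fE df fv;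
  have [||v [f' [hv ff' sv f'f [df' f'0]]]] := @greedy_trail f h h => //;
  do ?[by move=> k; rewrite df subrr].
- exists v; split=> //; last by lia.
  move=> [k s]; rewrite ff'; case: (f' (k, s) =P 0) => [->|/eqP f'k]; first by rewrite addr0.
  have := fv _ (f'f _ f'k); rewrite /= inE => /eqP /= kh.
  by move: f'k; rewrite kh (f'0 (s, false)) eqxx.
have [|||v' [hv' f'v' sv']] := IH (h * cls N [:: a])%g f' => //.
- by move=> e /f'f /fE.
- move=> [k s] f'e; have := fv _ (f'f _ f'e); rewrite /= inE => /orP[/eqP /= kh|//].
  by move: f'e; rewrite kh (f'0 (s, false)) eqxx.
(* The trail at [h], then one step along [t], the rest of the tour, and back. *)
exists (v ++ a :: v' ++ [:: letter_inv a]); split.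
- by rewrite cls_cat mulgA hv cls_cons cls_cat !mulgA hv' cls_letter_inv mulgK.
- move=> e; rewrite ff' flow_cat hv flow_cons flow_cat hv' flow_letter_inv -f'v'; lia.
- by rewrite size_cat /= size_cat /=; lia.
Qed.

Variable M : normal_subgroup (free_group X).
Hypothesis NM : M = subgroup_generated
  [set [~ x, y]%g | x in (N : set _) & y in (N : set _)]%classic :> set _.

(** A greedy trail leads from the endpoint of [u] to that of [v]; what it leaves
    over is a circulation, which a closed tour along [t] absorbs first. *)
Lemma tour_route u v t :
  (forall e, flow (1%g : H) u e != flow 1%g v e -> e \in E) ->
  (forall e, flow (1%g : H) u e != flow 1%g v e -> e.1 \in visits (cls N u) t) ->
  exists2 w, (cls M u * cls M w)%g = cls M v &
    (size w <= 2 * size t + mass (fun e => (flow (1%g : H) v e - flow 1%g u e)%R))%N.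
Proof.
move=> uvE uvt; set f := (X in mass X).
have fE e : f e != 0 -> flow (1%g : H) u e != flow 1%g v e.
  by rewrite /f subr_eq0 eq_sym.
have [||v1 [f' [hv1 ff' sv1 f'f [df' _]]]] := @greedy_trail f (cls N u) (cls N v).
- by move=> e /fE /uvE.
- by move=> k; rewrite divgB !divg_flow !mul1g; ring.
have [|||v2 [hv2 f'v2 sv2]] := @closed_tour t f' (cls N u) => //.
- by move=> e /f'f /fE /uvE.
- by move=> e /f'f /fE /uvt.
exists (v2 ++ v1); last by rewrite size_cat; lia.
rewrite -cls_cat; apply: (flow_inj NM).
  by rewrite !cls_cat mulgA hv2.
move=> e; rewrite flow_cat mul1g flow_cat hv2 -f'v2.
by rewrite (addrC (f' e)) -ff' /f addrC subrK.
Qed.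

End Tours.

(** * Symmetric differences of finite sets *)

Section SymDiff.
Variable I : choiceType.
Implicit Types (A B D : {fset I}).

Definition symd A B := ((A `\` B) `|` (B `\` A))%fset.

Lemma mem_symd A B i : (i \in symd A B) = ((i \in A) != (i \in B)).
Proof. by rewrite !inE; case: (i \in A); case: (i \in B). Qed.

Lemma symd_triangle A B D : {subset symd A D <= symd A B ++ symd B D}.
Proof.
move=> i; rewrite mem_cat !mem_symd.
by case: (i \in A); case: (i \in B); case: (i \in D).
Qed.

End SymDiff.

Lemma ler_sum_subset (R : realDomainType) (I : eqType) (s s' : seq I) (w : I -> R) :
  (forall i, 0 <= w i) -> uniq s -> {subset s <= s'} ->
  \sum_(i <- s) w i <= \sum_(i <- s') w i.
Proof.
move=> w0; elim: s s' => [|i s IH] s' /=; first by rewrite big_nil sumr_ge0.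
move=> /andP[isN us] ss'; have iS : i \in s' by apply: ss'; rewrite inE eqxx.
rewrite (perm_big _ (perm_to_rem iS)) !big_cons lerD2l; apply: IH => // j js.
have := ss' j; rewrite inE js orbT => /(_ isT).
rewrite (perm_mem (perm_to_rem iS)) inE => /orP[/eqP ji|//].
by move: isN; rewrite -ji js.
Qed.

Lemma ler_sum_inj (R : realDomainType) (I J : eqType) (f : I -> J) (s : seq I) (s' : seq J)
   (w : I -> R) (w' : J -> R) :
  (forall i, 0 <= w' i) -> uniq s -> {in s &, injective f} -> {in s, forall i, f i \in s'} ->
  {in s, forall i, w i <= w' (f i)} ->
  \sum_(i <- s) w i <= \sum_(j <- s') w' j.
Proof.
move=> w0 us fI fs ww'; apply: (@le_trans _ _ (\sum_(j <- map f s) w' j)).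
  by rewrite big_map !big_seq; apply: ler_sum => i; exact: ww'.
apply: ler_sum_subset => //; first by rewrite map_inj_in_uniq.
by move=> _ /mapP[i /fs ? ->].
Qed.

Section SumSets.
Variables (I1 I2 : choiceType).

Definition fset_sum (A1 : {fset I1}) (A2 : {fset I2}) : {fset (I1 + I2)%type} :=
  seq_fset tt (map inl A1 ++ map inr A2).

Lemma mem_fset_sum A1 A2 i : (i \in fset_sum A1 A2) =
  match i with inl i1 => i1 \in A1 | inr i2 => i2 \in A2 end.
Proof.
rewrite seq_fsetE mem_cat; case: i => i.
  rewrite mem_map; last by move=> ? ? [].
  by case: (i \in A1) => //=; apply/mapP => -[].
rewrite orbC mem_map; last by move=> ? ? [].
by case: (i \in A2) => //=; apply/mapP => -[].
Qed.

Lemma sum_symd_sum (R : realDomainType) (w1 : I1 -> R) (w2 : I2 -> R) A1 A2 B1 B2 :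
  \sum_(i <- symd (fset_sum A1 A2) (fset_sum B1 B2))
     (match i with inl i1 => w1 i1 | inr i2 => w2 i2 end) =
  \sum_(i <- symd A1 B1) w1 i + \sum_(i <- symd A2 B2) w2 i.
Proof.
rewrite (perm_big (map inl (symd A1 B1) ++ map inr (symd A2 B2))).
  by rewrite big_cat !big_map.
apply: uniq_perm; first exact: fset_uniq.
  rewrite cat_uniq !map_inj_uniq ?fset_uniq //=; try by move=> ? ? [].
  by rewrite andbT; apply/hasPn => _ /mapP[i _ ->]; apply/mapP => -[].
move=> i; rewrite mem_symd !mem_fset_sum mem_cat; case: i => i.
  rewrite (mem_map _ _ i) ?mem_symd; last by move=> ? ? [].
  by case: (_ != _) => //=; apply/esym/negbTE/mapP => -[].
rewrite orbC (mem_map _ _ i) ?mem_symd; last by move=> ? ? [].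
by case: (_ != _) => //=; apply/esym/negbTE/mapP => -[].
Qed.

End SumSets.

(** * Lifting walls from F/N to F/[N,N] *)

(** The signed integers between [0] and [z]. Their symmetric differences have as
    many elements as the distance of the integers, which turns an l1 distance into
    a count of walls. *)
Definition thresholds (z : int) : seq int :=
  match z with Posz n => map Posz (iota 0 n) | Negz n => map Negz (iota 0 n.+1) end.

Lemma mem_thresholds z (c : int) : (c \in thresholds z) = (0 <= c < z) || (z <= c < 0).
Proof.
case: z c => n [] c; rewrite /thresholds; set s := iota _ _.
- rewrite mem_map; last by move=> ? ? [].
  rewrite mem_iota; lia.
- by rewrite [LHS](_ : _ = false); [lia|apply/mapP => -[]].
- by rewrite [LHS](_ : _ = false); [lia|apply/mapP => -[]].
- rewrite mem_map; last by move=> ? ? [].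
  rewrite mem_iota; lia.
Qed.

Lemma thresholds_diff (y z c : int) :
  ((c \in thresholds y) != (c \in thresholds z)) =
  (Num.min y z <= c < Num.max y z).
Proof. rewrite !mem_thresholds; lia. Qed.

Section Lamplighter.
Variables (R : realType) (X : finType) (N M : normal_subgroup (free_group X)).
Hypothesis NM : M = subgroup_generated
  [set [~ x, y]%g | x in (N : set _) & y in (N : set _)]%classic :> set _.
Local Notation H := (quotient_group N).
Local Notation G := (quotient_group M).
Local Notation word := (seq (letter X)).
Implicit Types (u v w t : word) (h k : H) (a : letter X) (x y : G).

(** An element of F/[N,N] is seen as a lamplighter whose configuration is the flow
    and whose position, the cursor, is the image in F/N. *)
Definition gflow x : edge N -> int := flow 1%g (word_of x).
Definition cursor x : H := cls N (word_of x).

Lemma gflow_cls u : gflow (cls M u) = flow 1%g u.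
Proof.
by apply/funext => e; rewrite /gflow; have [_ ->] := flow_cls NM (word_ofK (cls M u)).
Qed.

Lemma cursor_cls u : cursor (cls M u) = cls N u.
Proof. by rewrite /cursor; have [-> _] := flow_cls NM (word_ofK (cls M u)). Qed.

Lemma cursorM x w : cursor (x * cls M w)%g = (cursor x * cls N w)%g.
Proof. by rewrite -[x]word_ofK -cls_cat !cursor_cls cls_cat. Qed.

Lemma gflowM x w e : gflow (x * cls M w)%g e = gflow x e + flow (cursor x) w e.
Proof. by rewrite -[x]word_ofK -cls_cat !gflow_cls flow_cat cursor_cls mul1g. Qed.

Definition gsupp x : seq (edge N) :=
  [seq e <- map fst (path_edges 1%g (word_of x)) | gflow x e != 0].

Lemma mem_gsupp x e : (e \in gsupp x) = (gflow x e != 0).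
Proof.
rewrite mem_filter; have [//|ne0] := eqVneq (gflow x e) 0; rewrite /=.
apply: contraNT ne0 => es; rewrite /gflow /flow !(count_memPn _) //.
  by apply: contra es => /(map_f fst).
by apply: contra es => /(map_f fst).
Qed.

Definition flow_walls x : {fset (edge N * int)%type} :=
  seq_fset tt [seq (e, c) | e <- gsupp x, c <- thresholds (gflow x e)].

Lemma mem_flow_walls x (e : edge N) c :
  ((e, c) \in flow_walls x) = (c \in thresholds (gflow x e)).
Proof.
rewrite seq_fsetE; apply/allpairsPdep/idP => [[e' [c' [_ ? [-> ->]]]]//|cT].
exists e, c; split=> //; rewrite mem_gsupp; apply: contraTneq cT => ->.
by [].
Qed.

Lemma flow_walls_step x a : exists z,
  {subset symd (flow_walls x) (flow_walls (x * cls M [:: a])%g) <= [:: z]}.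
Proof.
pose e0 := edge_of (cursor x) a; pose xa := (x * cls M [:: a])%g.
exists (e0, Num.min (gflow x e0) (gflow xa e0)) => -[e c].
rewrite mem_symd !mem_flow_walls thresholds_diff inE xpair_eqE -/xa.
have [->|ne] := eqVneq e e0; rewrite /=.
  rewrite /xa gflowM flow_letter eqxx; case: (a.2); rewrite ?expr0 ?expr1; lia.
by rewrite /xa gflowM flow_letter (negbTE ne); lia.
Qed.

Lemma flow_walls_ge (E : seq (edge N)) x y : uniq E ->
  (mass E (fun e => gflow y e - gflow x e))%:R
    <= \sum_(i <- symd (flow_walls x) (flow_walls y)) 1 :> R.
Proof.
move=> uE; pose L e := [seq Num.min (gflow x e) (gflow y e) + i%:Z |
  i <- iota 0 `|gflow y e - gflow x e|%N].
pose s := [seq (e, c) | e <- E, c <- L e].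
have -> : (mass E (fun e => gflow y e - gflow x e))%:R = \sum_(i <- s) 1 :> R.
  rewrite big_allpairs_dep /mass natr_sum; apply: eq_bigr => e _.
  by rewrite big_map big_const_seq count_predT size_iota iter_addr addr0.
apply: ler_sum_subset => //.
  apply: allpairs_uniq_dep => //.
  - by move=> e _; rewrite map_inj_uniq ?iota_uniq // => i j /addrI [].
  - by move=> [e c] [e' c'] _ _ /= [-> ->].
move=> _ /allpairsPdep[e [_ [_ /mapP[i il ->] ->]]].
rewrite mem_symd !mem_flow_walls thresholds_diff; move: il; rewrite mem_iota; lia.
Qed.

(** From [C j] one sees the flow on [Q j]. Given two points [h] and [k], only the
    finitely many [j] in [sep h k] see [k] from [h]. *)
Variables (J : choiceType) (wJ : J -> R) (C Q : J -> H -> bool) (sep : H -> H -> seq J).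
Hypothesis wJ0 : forall j, 0 <= wJ j.
Hypothesis CQ : forall j h, C j h -> ~~ Q j h.
Hypothesis sepP : forall h k j, (j \in sep h k) = C j h && Q j k.

Definition view j (f : edge N -> int) : edge N -> int :=
  fun e => if Q j e.1 then f e else 0.

(** The records of the zero configuration are omitted, which makes the set finite. *)
Definition view_walls x : {fset (J * (edge N -> int))%type} :=
  seq_fset tt [seq (j, view j (gflow x)) | e <- gsupp x, j <- sep (cursor x) e.1].

Lemma mem_view_walls x j f : reflect
  [/\ C j (cursor x), f = view j (gflow x) & f <> (fun=> 0)]
  ((j, f) \in view_walls x).
Proof.
rewrite seq_fsetE; apply: (iffP idP) => [/allpairsPdep[e [j' [es js [-> ->]]]]|[Cj -> f0]].
  move: js; rewrite sepP => /andP[Cj Qj]; split=> // /(congr1 (@^~ e)).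
  rewrite /view Qj; apply/eqP; by rewrite -mem_gsupp.
have [e re] : exists e, view j (gflow x) e <> 0.
  by apply: contrapT => /forallNP r0; apply: f0; apply/funext => e; apply: contrapT (r0 e).
move: re; rewrite /view; case: ifP => // Qe /eqP; rewrite -mem_gsupp => es.
by apply/allpairsPdep; exists e, j; rewrite sepP Cj Qe.
Qed.

(** A step changes the flow on an edge that starts at its old or new position. If
    both are in [C j], then this edge is not seen in [Q j], and the record does not
    change. So only those [j] matter for which [C j] separates the two positions,
    and each of them accounts for a single record. *)
Lemma view_walls_step x a : {in symd (view_walls x) (view_walls (x * cls M [:: a])%g) &,
  injective fst} /\ {in symd (view_walls x) (view_walls (x * cls M [:: a])%g),
  forall i, C i.1 (cursor x) != C i.1 (cursor x * cls N [:: a])%g}.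
Proof.
set y := (x * _)%g; set h := cursor x; pose k := cursor y.
have kE : (h * cls N [:: a])%g = k by rewrite /k /y cursorM.
have same j : C j h -> C j k -> view j (gflow y) = view j (gflow x).
  move=> /CQ nQh /CQ nQk; apply/funext => e; rewrite /view; case: ifP => // Qe.
  rewrite gflowM flow_letter; case: eqP => [ee|_]; last by rewrite addr0.
  move: Qe; rewrite ee /edge_of; case: a.2 => /=; rewrite -/h ?kE => Qe.
    by rewrite Qe in nQk.
  by rewrite Qe in nQh.
have main i : i \in symd (view_walls x) (view_walls y) ->
    (C i.1 h != C i.1 k) /\ (i.2 = view i.1 (if C i.1 h then gflow x else gflow y)).
  rewrite mem_symd; case: i => j f /=.
  case: mem_view_walls => [[Cx -> f0]|nx]; case: mem_view_walls => [[Cy fE g0]|ny] //= _.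
    rewrite -/h in Cx *; rewrite Cx; split=> //; apply/eqP => /esym Ck; apply: ny.
    by rewrite -/k Ck same.
  rewrite -/k in Cy; rewrite Cy.
  have Cx : ~~ C j h by apply/negP => Cx; apply: nx; split=> //; rewrite fE same.
  by rewrite (negbTE Cx) fE.
split=> [[j f] [j' f'] /main[_ /= ->] /main[_ /= ->] /= -> //|i /main[]].
by rewrite kE.
Qed.

(** The two records are distinct, so at least one of them is nonzero. *)
Lemma view_walls_ge (v : J -> R) (B : seq J) x y : (forall j, 0 <= v j) -> uniq B ->
  {in B, forall j, [/\ C j (cursor x), C j (cursor y) &
    exists2 e, Q j e.1 & gflow x e != gflow y e]} ->
  \sum_(j <- B) v j <= \sum_(i <- symd (view_walls x) (view_walls y)) v i.1.
Proof.
move=> v0 uB BP.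
pose f j := if (j, view j (gflow x)) \in view_walls x
  then (j, view j (gflow x)) else (j, view j (gflow y)).
apply: (@ler_sum_inj _ _ _ f) => //.
- by move=> j j' _ _; rewrite /f; do 2 case: ifP => _; case.
- move=> j /BP[Cx Cy [e Qe ne]].
  have nexy : view j (gflow x) <> view j (gflow y).
    by move=> /(congr1 (@^~ e)); rewrite /view Qe; apply/eqP.
  rewrite mem_symd /f; case: ifPn => [jx|/mem_view_walls jx].
    by rewrite jx; case: mem_view_walls => // -[_ ? _].
  have x0 : view j (gflow x) = fun=> 0.
    by apply: contrapT => x0; apply: jx.
  have -> : (j, view j (gflow y)) \in view_walls y.
    by apply/mem_view_walls; split=> //; rewrite -x0 => /esym.
  by case: mem_view_walls => // -[_ /esym].
- by move=> j _; rewrite /f; case: ifP.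
Qed.

Variables (I : choiceType) (w : I -> R) (A : H -> {fset I}).
Hypothesis w0 : forall i, 0 <= w i.

Definition lamp_index : choiceType :=
  ((edge N * int) + (I + J * (edge N -> int)))%type.

Definition lamp_weight (i : lamp_index) : R :=
  match i with inl _ => 1 | inr (inl i) => w i | inr (inr j) => wJ j.1 end.

Definition lamp_walls x : {fset lamp_index} :=
  fset_sum (flow_walls x) (fset_sum (A (cursor x)) (view_walls x)).

Lemma lamp_weight_ge0 i : 0 <= lamp_weight i.
Proof. by case: i => [_|[i|j]] //=. Qed.

Lemma lamp_sum (g : R -> R) x y :
  \sum_(i <- symd (lamp_walls x) (lamp_walls y)) g (lamp_weight i) =
  \sum_(i <- symd (flow_walls x) (flow_walls y)) g 1 +
  (\sum_(i <- symd (A (cursor x)) (A (cursor y))) g (w i) +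
   \sum_(i <- symd (view_walls x) (view_walls y)) g (wJ i.1)).
Proof.
rewrite -!sum_symd_sum; apply: eq_bigr => i _.
by case: i => [|[]].
Qed.

Lemma lamp_step K KJ :
  (forall h a, \sum_(i <- symd (A h) (A (h * cls N [:: a])%g)) w i <= K) ->
  (forall h a B, uniq B -> {in B, forall j, C j h != C j (h * cls N [:: a])%g} ->
     \sum_(j <- B) wJ j <= KJ) ->
  forall x a,
    \sum_(i <- symd (lamp_walls x) (lamp_walls (x * cls M [:: a])%g)) lamp_weight i <= 1 + (K + KJ).
Proof.
move=> HK HJ x a; rewrite (lamp_sum id); apply: lerD; last apply: lerD.
- have [z sz] := flow_walls_step x a; apply: le_trans (_ : \sum_(i <- [:: z]) 1 <= _).
    by apply: ler_sum_subset => //; exact: fset_uniq.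
  by rewrite big_seq1.
- by rewrite cursorM.
have [fi fC] := view_walls_step x a; rewrite -(big_map fst xpredT wJ).
apply: (HJ (cursor x) a); first by rewrite map_inj_in_uniq // fset_uniq.
by move=> _ /mapP[i /fC ? ->].
Qed.

Lemma lamp_ge (q : R) x y :
  let Y := \sum_(i <- symd (lamp_walls x) (lamp_walls y)) lamp_weight i `^ q in
  [/\ forall E : seq (edge N), uniq E -> (mass E (fun e => gflow y e - gflow x e))%:R <= Y,
    \sum_(i <- symd (A (cursor x)) (A (cursor y))) w i `^ q <= Y &
    forall B, uniq B ->
     {in B, forall j, [/\ C j (cursor x), C j (cursor y) &
       exists2 e, Q j e.1 & gflow x e != gflow y e]} ->
     \sum_(j <- B) wJ j `^ q <= Y].
Proof.
rewrite /= (lamp_sum (fun z => z `^ q)) powR1.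
have s1 : 0 <= \sum_(i <- symd (flow_walls x) (flow_walls y)) 1 :> R by exact: sumr_ge0.
have s2 : 0 <= \sum_(i <- symd (A (cursor x)) (A (cursor y))) w i `^ q.
  by apply: sumr_ge0 => i _; exact: powR_ge0.
have s3 : 0 <= \sum_(i <- symd (view_walls x) (view_walls y)) wJ i.1 `^ q.
  by apply: sumr_ge0 => i _; exact: powR_ge0.
split.
- by move=> E uE; apply: (le_trans (flow_walls_ge x y uE)); rewrite lerDl addr_ge0.
- by rewrite addrCA lerDl addr_ge0.
- move=> B uB BP.
  have v0 j : 0 <= wJ j `^ q by exact: powR_ge0.
  apply: (le_trans (@view_walls_ge (fun j => wJ j `^ q) B x y v0 uB BP)).
  by rewrite addrA lerDr addr_ge0.
Qed.

End Lamplighter.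

(** * The inductive step *)

(** The weights enter with exponent 1 for a step and with exponent [q] in the lower
    bound, because these are the two sums between which Lp norms are controlled.
    Distances are expressed by words rather than by a word metric, so that no
    generating set is involved in the constructions. *)
Definition has_walls (R : realType) (X : finType) (N : normal_subgroup (free_group X))
    (q alpha : R) : Prop :=
  exists (I : choiceType) (w : I -> R) (A : quotient_group N -> {fset I}),
  [/\ forall i, 0 <= w i,
   exists K, forall h a, \sum_(i <- symd (A h) (A (h * cls N [:: a])%g)) w i <= K &
   exists2 c, 0 < c & forall h k, exists2 t, (h * cls N t)%g = k &
     c * (size t)%:R `^ alpha <= \sum_(i <- symd (A h) (A k)) w i `^ q].

Section Routes.
Variables (R : realType) (X : finType) (N M : normal_subgroup (free_group X)).
Hypothesis NM : M = subgroup_generated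
  [set [~ x, y]%g | x in (N : set _) & y in (N : set _)]%classic :> set _.
Local Notation H := (quotient_group N).
Local Notation G := (quotient_group M).
Implicit Types (t : seq (letter X)) (h k : H) (x y : G).

Definition diff_edges x y : seq (edge N) :=
  undup [seq e <- gsupp N x ++ gsupp N y | gflow (N:=N) x e != gflow y e].

Lemma mem_diff_edges x y e : (e \in diff_edges x y) = (gflow x e != gflow y e).
Proof.
rewrite mem_undup mem_filter mem_cat !mem_gsupp; case: eqVneq => //= ne.
have [e0|//] := eqVneq (gflow x e) 0; have [e1|//] := eqVneq (gflow y e) 0.
by rewrite e0 e1 in ne.
Qed.

Lemma diff_edges_uniq x y : uniq (diff_edges x y). Proof. exact: undup_uniq. Qed.

Definition flow_dist x y : nat := mass (diff_edges x y) (fun e => gflow y e - gflow x e).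

Lemma size_diff_edges x y : (size (diff_edges x y) <= flow_dist x y)%N.
Proof.
rewrite -sum1_size /flow_dist /mass big_seq [leqRHS]big_seq; apply: leq_sum => e.
by rewrite mem_diff_edges => ne; rewrite lt0n absz_eq0 subr_eq0 eq_sym.
Qed.

Lemma flow_route x y t :
  {in diff_edges x y, forall e, e.1 \in visits (cursor N x) t} ->
  exists2 w, (x * cls M w)%g = y & (size w <= 2 * size t + flow_dist x y)%N.
Proof.
move=> vt; have [||w xw sw] := @tour_route X N (diff_edges x y)
  (diff_edges_uniq x y) M NM (word_of x) (word_of y) t.
- by move=> e ne; rewrite mem_diff_edges.
- by move=> e ne; apply: vt; rewrite mem_diff_edges.
by exists w => //; move: xw; rewrite !word_ofK.
Qed.

Lemma star_tour (T : eqType) (pos : T -> H) (l : R) (s : seq T) h :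
  {in s, forall e, exists2 t, (h * cls N t)%g = pos e & (size t)%:R <= l} ->
  exists t, [/\ (h * cls N t)%g = h, (size t)%:R <= 2 * l * (size s)%:R &
    {in s, forall e, pos e \in visits h t}].
Proof.
elim: s => [_|e s IH es].
  by exists [::]; rewrite cls_nil mulg1 mulr0; split.
have [|t [ht st tv]] := IH; first by move=> e' e's; apply: es; rewrite inE e's orbT.
have [u hu su] := es e (mem_head _ _).
have hu' : (h * cls N (u ++ word_inv u))%g = h by rewrite cls_cat cls_inv mulgA mulgK.
exists ((u ++ word_inv u) ++ t); split.
- by rewrite cls_cat mulgA hu'.
- rewrite !size_cat /word_inv size_rev size_map /= !natrD -addn1 natrD; lra.
- move=> e'; rewrite inE mem_visits_cat hu' => /predU1P[->|/tv ->]; last by rewrite orbT.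
  by rewrite mem_visits_cat -hu visits_last.
Qed.

End Routes.

Lemma powR_le_root (R : realType) (s D Y g : R) : 0 < g -> 0 <= s -> 0 < D -> 0 <= Y ->
  s <= D * Y `^ g -> (D `^ g^-1)^-1 * s `^ g^-1 <= Y.
Proof.
move=> g0 s0 D0 Y0 sDY; rewrite ler_pdivrMl ?powR_gt0 //.
have -> : D `^ g^-1 * Y = (D * Y `^ g) `^ g^-1.
  by rewrite powRM ?powR_ge0 ?ltW // -powRrM mulfV ?gt_eqF // powRr1.
by apply: ge0_ler_powR; rewrite ?nnegrE ?invr_ge0 ?(ltW g0) // mulr_ge0 ?powR_ge0 // ltW.
Qed.

Section WallsStep.
Variables (R : realType) (X : finType) (N M : normal_subgroup (free_group X)).
Hypothesis NM : M = subgroup_generated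
  [set [~ x, y]%g | x in (N : set _) & y in (N : set _)]%classic :> set _.
Variables (q alpha : R).
Hypothesis alpha0 : 0 < alpha.

(** A place [k] where the flows differ, at distance D from the cursor, is separated
    from it by walls of weight D^alpha. Such a wall either separates the two
    cursors or gives a view. With n the mass of the flow difference and Y the total
    weight, this gives n <= Y and D^alpha <= C Y. Visiting the n places from the
    cursor one by one costs at most 2 n D, which is of order Y^(1 + 1 / alpha). *)
Lemma walls_step : has_walls N q alpha -> has_walls M q (alpha / (1 + alpha)).
Proof.
move=> [I [w [A [w0 [K HK] [c c0 low]]]]].
pose C (j : I * bool) h := (j.1 \in A h) == j.2.
pose Q (j : I * bool) h := (j.1 \in A h) != j.2.
pose sep h k := [seq (i, i \in A h) | i <- symd (A h) (A k)].
have sepP h k j : (j \in sep h k) = C j h && Q j k.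
  apply/mapP/andP => [[i iAA ->]|[/eqP Cj Qj]] /=; rewrite /C /Q /=.
    by move: iAA; rewrite mem_symd eqxx eq_sym.
  exists j.1; last by rewrite Cj; case: (j).
  by rewrite mem_symd Cj eq_sym.
have CQ j h : C j h -> ~~ Q j h by rewrite /Q negbK.
pose wJ (j : I * bool) := w j.1.
have wJ0 j : 0 <= wJ j by exact: w0.
exists _, (lamp_weight (X:=X) (N:=N) wJ w), (lamp_walls (M:=M) Q sep A); split.
- exact: lamp_weight_ge0.
- exists (1 + (K + (K + K))); apply: (lamp_step NM CQ sepP HK).
  move=> h a B uB BP; set D := symd (A h) (A (h * cls N [:: a])%g).
  apply: (@le_trans _ _ (\sum_(j <- map (pair^~ true) D ++ map (pair^~ false) D) wJ j)).
    apply: ler_sum_subset => // -[i b] /BP; rewrite /C /= => nib.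
    have iD : i \in D.
      by rewrite mem_symd; apply: contraNN nib => /eqP ->.
    by rewrite mem_cat; case: (b); rewrite (map_f _ iD) ?orbT.
  by rewrite big_cat !big_map; apply: lerD; exact: HK.
pose b := alpha / (1 + alpha); pose D := 4 * (2 / c) `^ alpha^-1 + 1.
have D0 : 0 < D by rewrite ltr_wpDl // mulr_ge0 ?powR_ge0.
have g0 : 0 < 1 + alpha^-1 by rewrite ltr_wpDr // invr_ge0 ltW.
have bE : b = (1 + alpha^-1)^-1.
  by rewrite /b; field; rewrite !gt_eqF // ?addr_gt0.
exists (D `^ b)^-1; first by rewrite invr_gt0 powR_gt0.
move=> x y; have := lamp_ge wJ sepP w A q x y; set Y := \sum_(i <- _) _.
move=> [flowY cursorY viewY].
have Y0 : 0 <= Y by apply: sumr_ge0 => i _; exact: powR_ge0.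
have fY : (flow_dist N x y)%:R <= Y by apply: flowY; exact: diff_edges_uniq.
have sY : (size (diff_edges N x y))%:R <= Y.
  by apply: le_trans fY; rewrite ler_nat size_diff_edges.
pose l := (2 * Y / c) `^ alpha^-1.
have [|t [_ st tv]] := @star_tour R X N _ (fun e : edge N => e.1) l
  (diff_edges N x y) (cursor N x).
  move=> e; rewrite mem_diff_edges => ne.
  have [t ht tl] := low (cursor N x) e.1; exists t => //.
  have : c * (size t)%:R `^ alpha <= 2 * Y.
    apply: (le_trans tl); set S := symd _ _.
    set P := symd (A (cursor N x)) (A (cursor N y)) in cursorY.
    (* [P] consists of the walls that also separate the two cursors; the other
       ones have both cursors on the same side, and view [e] from there. *)
    rewrite (bigID (mem P)) /= mulr_natl mulr2n; apply: lerD.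
      apply: le_trans cursorY; rewrite -big_filter; apply: ler_sum_subset.
      - by move=> i; exact: powR_ge0.
      - by rewrite filter_uniq // fset_uniq.
      - by move=> i; rewrite mem_filter => /andP[].
    pose B := [seq (i, i \in A (cursor N x)) | i <- S & i \notin P].
    rewrite -big_filter; have := viewY B; rewrite big_map; apply.
      by rewrite map_inj_uniq ?filter_uniq ?fset_uniq // => i i' [].
    move=> _ /mapP[i + ->]; rewrite mem_filter !mem_symd negbK => /andP[/eqP iP iS].
    rewrite /C /= eqxx -iP eqxx; split=> //; exists e => //.
    by rewrite /Q /= eq_sym.
  move=> tY; have -> : (size t)%:R = ((size t)%:R `^ alpha) `^ alpha^-1 :> R.
    by rewrite -powRrM mulfV ?gt_eqF // powRr1.
  apply: ge0_ler_powR; rewrite ?nnegrE ?invr_ge0 ?powR_ge0 ?(ltW alpha0) //.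
    by rewrite divr_ge0 ?mulr_ge0 // ltW.
  by rewrite ler_pdivlMr // mulrC.
have [u xu su] := flow_route NM tv; exists u => //.
rewrite -/b bE; apply: powR_le_root => //.
have suR : (size u)%:R <= 2 * (size t)%:R + (flow_dist N x y)%:R :> R.
  by rewrite -natrM -natrD ler_nat.
(* If [Y < 1] there is no flow difference at all, and [u] is empty. *)
have [Y1|Y1] := ltP Y 1.
  have s0 : size (diff_edges N x y) = 0%N.
    by apply/eqP; rewrite -leqn0 -ltnS -(ltr_nat R); exact: le_lt_trans Y1.
  have f0 : flow_dist N x y = 0%N.
    by apply/eqP; rewrite -leqn0 -ltnS -(ltr_nat R); exact: le_lt_trans Y1.
  apply: (@le_trans _ _ 0); last by rewrite mulr_ge0 ?powR_ge0 // ltW.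
  by move: suR st; rewrite s0 f0 mulr0; lra.
have lE : l = (2 / c) `^ alpha^-1 * Y `^ alpha^-1.
  rewrite /l mulrAC powRM //; last by rewrite divr_ge0 // ltW.
have YE : Y `^ (1 + alpha^-1) = Y * Y `^ alpha^-1.
  by rewrite powRD ?powRr1 //; rewrite gt_eqF ?implybT // (lt_le_trans _ Y1).
have Yp1 : 1 <= Y `^ alpha^-1 by rewrite -(powRr0 Y) ler_powR // invr_ge0 ltW.
rewrite YE /D; apply: (le_trans suR).
have tY : (size t)%:R <= 2 * l * Y.
  by apply: (le_trans st); rewrite ler_wpM2l // mulr_ge0 // powR_ge0.
apply: (@le_trans _ _ (2 * (2 * l * Y) + Y)); first lra.
rewrite lE [leRHS]mulrDl mul1r; apply: lerD; last by rewrite ler_peMr.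
by rewrite le_eqVlt; apply/orP; left; apply/eqP; ring.
Qed.

End WallsStep.

(** * The free abelian group *)

Section TrivialBase.
Variables (R : realType) (X : finType) (N M : normal_subgroup (free_group X)).
Hypothesis NM : M = subgroup_generated
  [set [~ x, y]%g | x in (N : set _) & y in (N : set _)]%classic :> set _.
Hypothesis N1 : forall h k : quotient_group N, h = k.
Local Notation G := (quotient_group M).
Implicit Types (x y : G).

(** When F/N is trivial its Cayley graph is a bouquet of circles, and the flow
    counts the exponent sum of each generator. *)
Definition coord x (s : X) : int := gflow (N:=N) x (1%g, s).

Lemma coordM x a s :
  coord (x * cls M [:: a])%g s = coord x s + (if s == a.1 then (-1) ^+ a.2 else 0).
Proof.
rewrite /coord (gflowM NM) flow_letter.
have -> : edge_of (cursor N x) a = (1%g, a.1) by congr pair; exact: N1.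
by rewrite xpair_eqE eqxx.
Qed.

Lemma coord_route x y :
  exists2 w, (x * cls M w)%g = y & (size w <= \sum_s `|coord y s - coord x s|%N)%N.
Proof.
have [|w xw sw] := @flow_route X N M NM x y [::].
  by move=> e _; rewrite (N1 e.1 (cursor N x)) visits_head.
exists w => //; apply: (leq_trans sw).
rewrite muln0 add0n /flow_dist /mass -(ler_nat int) !natr_sum.
rewrite -(big_map (fun s : X => (1%g : quotient_group N, s)) xpredT
   (fun e => `|gflow y e - gflow x e|%N%:R : int)).
apply: ler_sum_subset => //; first exact: diff_edges_uniq.
move=> [h s] _; rewrite (N1 h 1%g); apply: map_f; exact: mem_index_enum.
Qed.

Lemma coord_walls (q : R) : has_walls M q 1.
Proof.
pose C (j : void) (h : quotient_group N) := false.
pose sep (h k : quotient_group N) : seq void := [::].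
have sepP h k j : (j \in sep h k) = C j h && C j k by case: j.
have CQ j h : C j h -> ~~ C j h by [].
pose w0 (i : void) : R := 0; pose A (h : quotient_group N) : {fset void} := fset0.
exists _, (lamp_weight (X:=X) (N:=N) w0 w0), (lamp_walls (M:=M) C sep A); split.
- by apply: lamp_weight_ge0 => -[].
- exists (1 + (0 + 0)); apply: (lamp_step NM CQ sepP).
    by move=> h a; rewrite big1.
  by move=> h a B _ _; rewrite big1.
exists 1 => // x y; have [flowY _ _] := lamp_ge w0 sepP w0 A q x y.
have [|w xw sw] := @flow_route X N M NM x y [::].
  by move=> e _; rewrite (N1 e.1 (cursor N x)) visits_head.
exists w => //; rewrite mul1r powRr1 //.
apply: le_trans (flowY (diff_edges N x y) _); last exact: diff_edges_uniq.
by rewrite ler_nat; exact: sw.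
Qed.

End TrivialBase.

(** * Tours built by insertion *)

Lemma exists_argmin (T : eqType) (f : T -> nat) (s : seq T) x : x \in s ->
  exists2 p, p \in s & {in s, forall p', f p <= f p'}%N.
Proof.
elim: s x => // y s IH x _; case: s IH => [_|z s /(_ z (mem_head _ _)) [p ps pm]].
  by exists y; rewrite ?mem_head // => p'; rewrite inE => /eqP ->.
have [le|lt] := leqP (f y) (f p).
  exists y; rewrite ?mem_head // => p'; rewrite in_cons => /predU1P[->//|/pm].
  exact: leq_trans.
exists p; first by rewrite inE ps orbT.
by move=> p'; rewrite in_cons => /predU1P[->|/pm //]; exact: ltnW.
Qed.

Section InsertionTours.
Variables (X : finType) (N : normal_subgroup (free_group X)).
Local Notation H := (quotient_group N).
Implicit Types (t : seq (letter X)) (h k p : H).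

Lemma visits_split p h t : p \in visits h t ->
  exists t1 t2, t = t1 ++ t2 /\ (h * cls N t1)%g = p.
Proof.
elim: t h => [|a t IH] h; rewrite /= inE;
  [move=> /eqP ->|move=> /predU1P[->|/IH[t1 [t2 [-> <-]]]]].
- by exists [::], [::]; rewrite cls_nil mulg1.
- by exists [::], (a :: t); rewrite cls_nil mulg1.
- by exists (a :: t1), t2; rewrite cls_cons mulgA.
Qed.

Lemma insert_detour h t p u : (h * cls N t)%g = h -> p \in visits h t ->
  exists t', [/\ (h * cls N t')%g = h, size t' = (size t + 2 * size u)%N &
    {subset (p * cls N u)%g :: visits h t <= visits h t'}].
Proof.
move=> ht /visits_split[t1 [t2 [tE hp]]].
have uu : (p * cls N (u ++ word_inv u))%g = p by rewrite cls_cat cls_inv mulgA mulgK.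
exists (t1 ++ (u ++ word_inv u) ++ t2); split.
- by rewrite cls_cat mulgA hp cls_cat mulgA uu -hp -mulgA -cls_cat -tE.
- by rewrite tE !size_cat /word_inv size_rev size_map; lia.
move=> k; rewrite inE tE !mem_visits_cat hp uu => /predU1P[->|].
  by rewrite visits_last !orbT.
by case/orP => ->; rewrite ?orbT.
Qed.

Variables (nrm : H -> H -> nat) (c : nat).
Hypothesis nrm_route : forall h k, exists2 u, (h * cls N u)%g = k & (size u <= c * nrm h k)%N.

(** Each point is inserted as a detour from the nearest point visited before. [D]
    pairs each point with the distance it has to that one, hence with a lower bound
    for its distance to all the points before it. *)
Lemma insertion_tour h t0 (P0 L : seq H) :
  (h * cls N t0)%g = h -> h \in P0 -> {subset P0 <= visits h t0} ->
  exists t (D : seq (H * nat)),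
  [/\ (h * cls N t)%g = h /\ {subset P0 ++ L <= visits h t}, map fst D = L,
      size t <= size t0 + \sum_(i <- D) 2 * (c * i.2),
      {in D, forall i, {in P0, forall p, i.2 <= nrm p i.1}} &
      pairwise [rel i j | j.2 <= nrm i.1 j.1] D]%N.
Proof.
move=> ht0 hP0 P0t0; elim/last_ind: L => [|L e [t [D [[ht st] DL tD DP DD]]]].
  by exists t0, [::]; split; rewrite ?cats0 ?big_nil ?addn0.
have [|p ps pm] := @exists_argmin _ (nrm^~ e) (P0 ++ L) h; first by rewrite mem_cat hP0.
have [u pu su] := nrm_route p e.
have [t' [ht' st' vt']] := insert_detour u ht (st _ ps).
exists t', (rcons D (e, nrm p e)); split.
- split=> // k; rewrite -cats1 catA mem_cat => /orP[/st kt|].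
    by apply: vt'; rewrite inE kt orbT.
  by rewrite inE => /eqP ->; apply: vt'; rewrite inE pu eqxx.
- by rewrite map_rcons DL.
- rewrite -cats1 big_cat big_seq1 /= st'; lia.
- move=> i; rewrite mem_rcons inE => /predU1P[-> p' p'P|/DP //].
  by apply: pm; rewrite mem_cat p'P.
- rewrite pairwise_rcons DD andbT; apply/allP => i iD /=; apply: pm.
  by rewrite mem_cat -DL map_f ?orbT.
Qed.

End InsertionTours.

(** * Subadditivity of concave powers *)

(** By concavity each of [a] and [b], divided by [a + b], is at most its own power. *)
Lemma powR_subadd (R : realType) (a b g : R) : 0 <= a -> 0 <= b -> 0 < g <= 1 ->
  (a + b) `^ g <= a `^ g + b `^ g.
Proof.
move=> a0 b0 /andP[g0 g1]; have [ab0|ab0] := eqVneq (a + b) 0.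
  by rewrite ab0 powR0 ?gt_eqF // addr_ge0 ?powR_ge0.
have abp : 0 < a + b by rewrite lt_def ab0 addr_ge0.
have key x : 0 <= x -> x <= a + b -> x / (a + b) * (a + b) `^ g <= x `^ g.
  move=> x0 xab; have [->|xn0] := eqVneq x 0.
    by rewrite !mul0r powR_ge0.
  have xp : 0 < x by rewrite lt_def xn0.
  have xS : 0 < x / (a + b) <= 1 by rewrite divr_gt0 //= ler_pdivrMr // mul1r.
  have -> : x `^ g = (x / (a + b)) `^ g * (a + b) `^ g.
    by rewrite -powRM ?divr_ge0 ?addr_ge0 // divfK.
  rewrite ler_wpM2r ?powR_ge0 //; have := ger_powR xS g1.
  by rewrite powRr1 ?divr_ge0 ?addr_ge0.
have := lerD (key a a0 _) (key b b0 _).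
rewrite -mulrDl -mulrDl mulfV // mul1r; apply; first by rewrite lerDl.
by rewrite lerDr.
Qed.

(** * Grids over the free abelian group *)

(** The cells of scale [i] have odd side [3 ^ i], so that they are the balls of
    radius [half_side i] in the sup norm about the multiples of [3 ^ i]. *)
Definition half_side k : nat := ((3 ^ k).-1)./2.

Lemma half_sideE k : (3 ^ k = 2 * half_side k + 1)%N.
Proof.
have o3 : odd (3 ^ k) by rewrite oddX orbT.
have := odd_double_half (3 ^ k).-1; rewrite -/(half_side k) -(odd_double_half (3 ^ k)) o3 /=.
by rewrite odd_double; lia.
Qed.

Lemma half_side_ge k : (k <= half_side k)%N.
Proof.
have : (2 * k + 1 <= 3 ^ k)%N by elim: k => // k IH; rewrite expnS; lia.
by have := half_sideE k; lia.
Qed.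

Section Grid.
Variables (R : realType) (X : finType) (N M : normal_subgroup (free_group X)).
Hypothesis NM : M = subgroup_generated
  [set [~ x, y]%g | x in (N : set _) & y in (N : set _)]%classic :> set _.
Local Notation H := (quotient_group N).
Local Notation G := (quotient_group M).
Variable co : H -> X -> int.
Hypothesis coS : forall h a s,
  co (h * cls N [:: a])%g s = co h s + (if s == a.1 then (-1) ^+ a.2 else 0).
Hypothesis coR : forall h k, exists2 w, (h * cls N w)%g = k &
  (size w <= \sum_s `|co k s - co h s|%N)%N.
Implicit Types (h k e : H) (z : {ffun X -> int}) (i c : nat).

Definition sup_dist h k : nat := \max_s `|co k s - co h s|%N.

Lemma sup_dist_route h k :
  exists2 w, (h * cls N w)%g = k & (size w <= #|X| * sup_dist h k)%N.
Proof.
have [w hw sw] := coR h k; exists w => //; apply: (leq_trans sw).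
rewrite -sum_nat_const; apply: leq_sum => s _.
by rewrite /sup_dist (leq_bigmax s).
Qed.

(** The distance from [h] to the centre of the cell [z] of scale [i]. *)
Definition center_dist h i z : nat := \max_s `|(co h s - z s * (3 ^ i)%N%:Z)%R|%N.

Lemma center_dist_leP h i z n :
  reflect (forall s, `|(co h s - z s * (3 ^ i)%N%:Z)%R| <= n)%N
          (center_dist h i z <= n)%N.
Proof.
by apply: (iffP (bigmax_leqP _ _ _)) => [le s|le s _]; [exact: le|exact: le].
Qed.

Lemma center_dist_ge h i z s : (`|(co h s - z s * (3 ^ i)%N%:Z)%R| <= center_dist h i z)%N.
Proof. by rewrite /center_dist (leq_bigmax s). Qed.

Definition cell i h : {ffun X -> int} :=
  [ffun s => ((co h s + half_side i) %/ (3 ^ i)%N)%Z].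

Lemma center_dist_cell h i : (center_dist h i (cell i h) <= half_side i)%N.
Proof.
apply/center_dist_leP => s; rewrite ffunE; have := half_sideE i; set P := (3 ^ i)%N => PE.
have P0 : (P%:Z != 0) by lia.
have := divz_eq (co h s + half_side i) P; have := modz_ge0 (co h s + half_side i) P0.
have := ltz_pmod (co h s + half_side i) (_ : 0 < P%:Z).
move: (_ %/ _)%Z (_ %% _)%Z => y r; lia.
Qed.

Lemma cell_unique h i z : (center_dist h i z <= half_side i)%N -> z = cell i h.
Proof.
move=> /center_dist_leP oz; have /center_dist_leP oc := center_dist_cell h i; apply/ffunP => s.
have := oz s; have := oc s; have := half_sideE i.
move: (cell i h s) (z s) (co h s) (3 ^ i)%N (half_side i) => y x a P m; nia.
Qed.

Lemma center_dist_triangle h k i z : (sup_dist h k <= center_dist h i z + center_dist k i z)%N.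
Proof.
apply/bigmax_leqP => s _; have := center_dist_ge h i z s; have := center_dist_ge k i z s; lia.
Qed.

Lemma center_dist_step h a i z : (center_dist (h * cls N [:: a])%g i z <= (center_dist h i z).+1)%N
  /\ (center_dist h i z <= (center_dist (h * cls N [:: a])%g i z).+1)%N.
Proof.
have st s : (`|co (h * cls N [:: a])%g s - co h s| <= 1)%N.
  by rewrite coS; case: eqP => _; case: (a.2) => /=; rewrite ?expr0 ?expr1; lia.
split; apply/center_dist_leP => s.
  by have := center_dist_ge h i z s; have := st s; lia.
by have := center_dist_ge (h * cls N [:: a])%g i z s; have := st s; lia.
Qed.

Local Notation cell_index := (nat * {ffun X -> int} * nat)%type.
Implicit Types j : cell_index.

(** An index [((i, z), c)] consists of a scale, a cell and a threshold: the cell is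
    viewed from the points at distance more than [c] from it. *)
Definition viewed_from j h :=
  (half_side j.1.1 + j.2 < center_dist h j.1.1 j.1.2)%N && (j.2 < 3 ^ j.1.1)%N.
Definition in_cell j h := (center_dist h j.1.1 j.1.2 <= half_side j.1.1)%N.

Lemma viewed_notin_cell j h : viewed_from j h -> ~~ in_cell j h.
Proof. rewrite /viewed_from /in_cell; lia. Qed.

(** The cell of [e] has diameter less than [3 ^ i], so at distance twice that from
    [e] one is beyond all the thresholds. *)
Lemma viewed_of_dist p e i c : (2 * 3 ^ i <= sup_dist p e)%N -> (c < 3 ^ i)%N ->
  viewed_from ((i, cell i e), c) p.
Proof.
move=> pe ci; apply/andP; split=> //=.
have := center_dist_triangle p e i (cell i e); have := center_dist_cell e i; have := half_sideE i.
by lia.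
Qed.

Definition origin_dist h := center_dist h 0 [ffun=> 0].

Lemma center_dist0 h i : center_dist h i [ffun=> 0] = origin_dist h.
Proof. by apply: eq_bigr => s _; rewrite !ffunE !mul0r. Qed.

Definition sep_cells h e : seq cell_index :=
  [seq j <- [seq ((i, cell i e), c) | i <- iota 0 (origin_dist h + origin_dist e).+1,
     c <- iota 0 (3 ^ i)] | viewed_from j h && in_cell j e].

(** At a scale larger than both distances to the origin, [h] and [e] lie in the
    central cell. So only finitely many scales contribute. *)
Lemma sep_cellsP h e j : (j \in sep_cells h e) = viewed_from j h && in_cell j e.
Proof.
rewrite mem_filter; case fn : (viewed_from j h && in_cell j e); last by [].
rewrite andTb; apply/idP.
move: fn; case: j => [[i z] c] /andP[/andP[oh c3] oe].
apply/allpairsPdep; exists i, c; rewrite /= in oh c3 oe.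
rewrite !mem_iota add0n c3 -(cell_unique oe); split=> //.
rewrite ltnNge; apply/negP => iK.
have hi := half_side_ge i.
have z0 : z = [ffun=> 0].
  by rewrite [z](cell_unique oe); apply/esym/cell_unique; rewrite center_dist0 /=; lia.
by move: oh; rewrite z0 center_dist0; lia.
Qed.

Variable lam : R.
Hypothesis lam01 : 0 <= lam < 1.

Definition cell_weight j : R := lam ^+ j.1.1.

Lemma cell_weight_ge0 j : 0 <= cell_weight j.
Proof. by rewrite exprn_ge0 //; case/andP: lam01. Qed.

Lemma geometric_le n : \sum_(i <- iota 0 n) lam ^+ i <= (1 - lam)^-1.
Proof.
case/andP: lam01 => l0 l1.
have -> : iota 0 n = index_iota 0 n by rewrite /index_iota subn0.
have := subrX1 lam n; rewrite big_mkord => E.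
rewrite -[leRHS]mul1r ler_pdivlMr ?subr_gt0 //.
have : 0 <= lam ^+ n by exact: exprn_ge0.
by move: E; set S := \sum_(_ < _) _; nra.
Qed.

(** At a given scale, if a step from [h] crosses one of the thresholds around a cell,
    then each coordinate of this cell differs by at most 2 from that of the cell of
    [h], and the threshold is unique. The geometric decay of the weights makes the
    sum over the scales converge. *)
Lemma cell_weight_step h a (B : seq cell_index) : uniq B ->
  {in B, forall j, viewed_from j h != viewed_from j (h * cls N [:: a])%g} ->
  \sum_(j <- B) cell_weight j <= #|{: {ffun X -> 'I_5}}|%:R * (1 - lam)^-1.
Proof.
move=> uB BP; pose f j : nat * {ffun X -> 'I_5} :=
  (j.1.1, [ffun s => inord `|(j.1.2 s - cell j.1.1 h s + 2)%R|%N]).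
pose n := (\max_(j <- B) j.1.1).+1.
pose D := [seq (i, o) | i <- iota 0 n, o <- enum {: {ffun X -> 'I_5}}].
pose w' (p : nat * {ffun X -> 'I_5}) := lam ^+ p.1.
have w'0 p : 0 <= w' p by rewrite exprn_ge0 //; case/andP: lam01.
have near_cell j s : j \in B ->
    `|j.1.2 s - cell j.1.1 h s + 2| < 5 /\ (-2 <= j.1.2 s - cell j.1.1 h s).
  move=> /BP; rewrite /viewed_from; set i := j.1.1; set c := j.2; set z := j.1.2.
  have [] := center_dist_step h a i z; have := half_sideE i.
  have := center_dist_ge h i z s; have /center_dist_leP /(_ s) := center_dist_cell h i.
  move: (center_dist h i z) (center_dist _ i z) => o o'.
  move: (cell i h s) (z s) (co h s) => y x b.
  move: (3 ^ i)%N (half_side i) => P m; case: ltnP; case: ltnP; case: ltnP => //=; nia.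
apply: (@le_trans _ _ (\sum_(p <- D) w' p)).
  apply: (@ler_sum_inj _ _ _ f) => //.
  - move=> [[i z] c] [[i' z'] c'] jB j'B; rewrite /f /= => -[ii'].
    rewrite -ii' in j'B * => /ffunP zz.
    have ezz : z = z'.
      apply/ffunP => s; have := zz s; rewrite ffunE [RHS]ffunE => /(congr1 val) /=.
      have /= [l1 l2] := near_cell _ s jB; have /= [l3 l4] := near_cell _ s j'B.
      move: l1 l2 l3 l4; move: (cell _ _ _) => y l1 l2 l3 l4; rewrite !inordK; lia.
    rewrite -ezz in j'B *; congr (_, _).
    have := BP _ jB; have := BP _ j'B; rewrite /viewed_from /=.
    have [] := center_dist_step h a i z; lia.
  - move=> j jB; apply/allpairsPdep; exists j.1.1, (f j).2; rewrite mem_enum; split=> //.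
    rewrite mem_iota /= add0n ltnS; exact: leq_bigmax_seq.
rewrite big_allpairs_dep /= /w' /=.
under eq_bigr do rewrite big_const_seq count_predT -cardE iter_addr addr0 -mulr_natl.
by rewrite -mulr_sumr ler_wpM2l //; exact: geometric_le n.
Qed.

End Grid.

Lemma natr_powR_le (R : realType) (n : nat) (g : R) : 0 < g <= 1 -> n%:R `^ g <= n%:R.
Proof.
move=> /andP[g0 g1]; case: n => [|n]; first by rewrite powR0 // gt_eqF.
by rewrite -[leRHS]powRr1 // ler_powR // ler1n.
Qed.

Lemma powR_sum_le (R : realType) (T : Type) (s : seq T) (f : T -> R) (g : R) :
  0 < g <= 1 -> (forall i, 0 <= f i) ->
  (\sum_(i <- s) f i) `^ g <= \sum_(i <- s) f i `^ g.
Proof.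
move=> g01 f0; elim: s => [|i s IH].
  by rewrite !big_nil powR0 // gt_eqF //; case/andP: g01.
rewrite !big_cons; apply: (le_trans (powR_subadd _ _ g01)) => //.
  exact: sumr_ge0.
by rewrite lerD2l.
Qed.

Lemma powR_lt1_of_lt0 (R : realType) (a g : R) : 1 < a -> g < 0 -> a `^ g < 1.
Proof.
move=> a1 g0; rewrite /powR gt_eqF ?(lt_trans _ a1) // expR_lt1.
by rewrite nmulr_rlt0 // ln_gt0.
Qed.

Section WallsGrid.
Variables (R : realType) (X : finType) (N M : normal_subgroup (free_group X)).
Hypothesis NM : M = subgroup_generated
  [set [~ x, y]%g | x in (N : set _) & y in (N : set _)]%classic :> set _.
Local Notation H := (quotient_group N).
Local Notation G := (quotient_group M).
Variable co : H -> X -> int.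
Hypothesis coS : forall h a s,
  co (h * cls N [:: a])%g s = co h s + (if s == a.1 then (-1) ^+ a.2 else 0).
Hypothesis coR : forall h k, exists2 w, (h * cls N w)%g = k &
  (size w <= \sum_s `|co k s - co h s|%N)%N.

(** The largest scale at which twice the side of a cell is at most [n]. *)
Definition detour_scale (n : nat) := trunc_log 3 n./2.

Lemma detour_scale_bounds n : (2 <= n)%N ->
  (2 * 3 ^ detour_scale n <= n < 6 * 3 ^ detour_scale n)%N.
Proof.
move=> n2; have n0 : (0 < n./2)%N by lia.
have /andP[] := trunc_log_bounds (isT : 1 < 3)%N n0; rewrite -/(detour_scale n) expnS; lia.
Qed.

Definition cell_key (p : H * nat) := (detour_scale p.2, cell co (detour_scale p.2) p.1).

(** Two points in the same cell are closer to each other than twice its side, which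
    is at most the detour of the later point. *)
Lemma cell_keys_uniq (D : seq (H * nat)) :
  all (fun p => 2 <= p.2)%N D -> pairwise [rel i j | j.2 <= sup_dist co i.1 j.1]%N D ->
  uniq (map cell_key D).
Proof.
move=> D2 DD; rewrite uniq_pairwise pairwise_map.
apply: sub_in_pairwise D2 DD => -[e m] [e' n] /= m2 n2 nee; apply/eqP => -[mn ce].
rewrite mn in ce; have oe := center_dist_cell co e (detour_scale n); rewrite ce in oe.
have := center_dist_triangle co e e' (detour_scale n) (cell co (detour_scale n) e').
have := center_dist_cell co e' (detour_scale n); have := half_sideE (detour_scale n).
by have := @detour_scale_bounds n n2; lia.
Qed.

(** Let Y be the weight of the walls between two elements. In a tour by insertion
    that starts with the two cursors, a point with a detour of length m is at
    distance at least m from both. So its cell of scale about log m is viewed from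
    both cursors through about m thresholds, each of weight about m^(g - 1).
    Different points use different cells, whence the sum of m^g over the tour is at
    most a constant times Y. By subadditivity of the power g, so is the g-th power
    of the length of the tour. *)
Lemma walls_grid (q g : R) : 0 < q -> 0 < g < 1 -> has_walls N q 1 -> has_walls M q g.
Proof.
move=> q0 /andP[g0 g1] [I [w [A [w0 [K HK] [c c0 low]]]]].
have g01 : 0 < g <= 1 by rewrite g0 ltW.
pose lam : R := 3 `^ ((g - 1) / q).
have lam01 : 0 <= lam < 1.
  by rewrite powR_ge0 powR_lt1_of_lt0 ?ltr1n // pmulr_llt0 ?invr_gt0 // subr_lt0.
(* The weight is chosen so that the [3 ^ k] thresholds around a cell of scale [k]
   contribute [(3 ^ k) `^ g] in total to the lower bound. *)
have lamE k : (lam ^+ k) `^ q = (3 ^ k)%N%:R `^ (g - 1).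
  rewrite -powR_mulrn ?powR_ge0 // -!powRrM natrX -powR_mulrn // -powRrM.
  by congr (_ `^ _); field; rewrite gt_eqF.
exists _, (lamp_weight (X:=X) (N:=N) (@cell_weight R X lam) w),
  (lamp_walls (M:=M) (in_cell co) (sep_cells co) A); split.
- by apply: lamp_weight_ge0 => // j; exact: cell_weight_ge0.
- eexists; apply: (lamp_step NM (@viewed_notin_cell _ _ co) (sep_cellsP co) HK).
  by move=> h a B; exact: cell_weight_step.
pose cX := #|X|; pose E := 4 / c + 28 * cX%:R + 1.
have E0 : 0 < E by rewrite ltr_wpDl // addr_ge0 ?mulr_ge0 // invr_ge0 ltW.
exists E^-1; first by rewrite invr_gt0.
move=> x y; have := lamp_ge (@cell_weight R X lam) (sep_cellsP co) w A q x y.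
set Y := \sum_(i <- _) _ => -[flowY cursorY viewY].
have Y0 : 0 <= Y by apply: sumr_ge0 => i _; exact: powR_ge0.
have fY : (flow_dist N x y)%:R <= Y by apply: flowY; exact: diff_edges_uniq.
have sY : (size (diff_edges N x y))%:R <= Y.
  by apply: le_trans fY; rewrite ler_nat size_diff_edges.
set a := cursor N x in cursorY viewY; set b := cursor N y in cursorY viewY.
have [t0 ab] := low a b; rewrite powRr1 // => /le_trans/(_ cursorY) t0Y.
(* The tour starts by visiting the second cursor, so that the later points are
   far from both cursors. *)
pose t1 := t0 ++ word_inv t0.
have at1 : (a * cls N t1)%g = a by rewrite cls_cat cls_inv mulgA mulgK.
have P01 : {subset [:: a; b] <= visits a t1}.
  move=> k; rewrite !inE => /orP[/eqP->|/eqP->]; first exact: visits_head.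
  by rewrite mem_visits_cat -ab visits_last.
have [t [D [[at_ tv] DL tD DP DD]]] := insertion_tour (sup_dist_route coR)
  (map fst (diff_edges N x y)) at1 (mem_head _ _) P01.
have [|u xu su] := @flow_route X N M NM x y t.
  by move=> e eD; apply: tv; rewrite mem_cat map_f ?orbT.
exists u => //; rewrite ler_pdivrMl //.
pose D2 := [seq i <- D | (2 <= i.2)%N].
pose B := [seq (kz, j) | kz <- map cell_key D2, j <- iota 0 (3 ^ kz.1)].
have uB : uniq B.
  apply: allpairs_uniq_dep => [|kz _|[? ?] [? ?] _ _ /= [-> ->]] //; last exact: iota_uniq.
  apply: cell_keys_uniq; first exact: filter_all.
  by apply: subseq_pairwise DD; exact: filter_subseq.
have BY : \sum_(j <- B) cell_weight lam j `^ q <= Y.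
  apply: viewY uB _ => jj /allpairsPdep[kz [j [/mapP[i iD2 ->]]]].
  rewrite mem_iota add0n => /= j3 ->.
  move: iD2; rewrite mem_filter => /andP[i2 iD].
  have /andP[si _] := detour_scale_bounds i2.
  have viewedP p : p \in [:: a; b] -> viewed_from co (cell_key i, j) p.
    by move=> pP; apply: viewed_of_dist j3; exact: leq_trans si (DP _ iD _ pP).
  split; [by apply: viewedP; rewrite mem_head|by apply: viewedP; rewrite !inE eqxx orbT|].
  have : i.1 \in map fst (diff_edges N x y) by rewrite -DL map_f.
  by case/mapP => e; rewrite mem_diff_edges => ne ie; exists e => //;
    rewrite /in_cell /= -ie center_dist_cell.
have BE : \sum_(j <- B) cell_weight lam j `^ q = \sum_(i <- D2) (3 ^ detour_scale i.2)%N%:R `^ g.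
  rewrite big_allpairs_dep big_map; apply: eq_bigr => i _.
  rewrite /cell_weight /= lamE big_const_seq count_predT size_iota iter_addr addr0 -[LHS]mulr_natl.
  rewrite -[X in X * _]powRr1 // -powRD; last by rewrite natrX expf_neq0 ?implybT ?pnatr_eq0.
  by congr (_ `^ _); ring.
have D2Y : \sum_(i <- D2) i.2%:R `^ g <= 6 * Y.
  apply: (@le_trans _ _ (6 * \sum_(j <- B) cell_weight lam j `^ q)); last by rewrite ler_wpM2l.
  rewrite BE mulr_sumr big_seq [leRHS]big_seq; apply: ler_sum => i.
  rewrite mem_filter => /andP[/detour_scale_bounds/andP[_ i6] _].
  apply: (@le_trans _ _ ((6 * 3 ^ detour_scale i.2)%N%:R `^ g)).
    by apply: ge0_ler_powR; rewrite ?nnegrE // ?(ltW g0) // ler_nat ltnW.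
  by rewrite natrM powRM // ler_wpM2r ?powR_ge0 // natr_powR_le.
have DY : \sum_(i <- D) i.2%:R `^ g <= 7 * Y.
  rewrite (bigID (fun i : H * nat => 2 <= i.2)%N) /= -big_filter -/D2.
  (* Detours of length at most 1 have no scale; there are at most as many of them
     as edges where the flows differ. *)
  have : \sum_(i <- D | ~~ (1 < i.2)%N) (i.2%:R `^ g : R) <= Y.
    apply: le_trans sY; rewrite -(size_map fst) -DL size_map -sum1_size natr_sum.
    apply: (@le_trans _ _ (\sum_(i <- D | ~~ (1 < i.2)%N) 1)).
      apply: ler_sum => i; rewrite -leqNgt => i1.
      by apply: (le_trans (natr_powR_le _ g01)); rewrite -[leRHS]/(1%:R) ler_nat.
    rewrite [leRHS](bigID (fun i : H * nat => ~~ (2 <= i.2)%N)) /= lerDl.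
    exact: sumr_ge0.
  lra.
have sizeu : (size u <= 4 * size t0 + (\sum_(i <- D) (4 * cX) * i.2 + flow_dist N x y))%N.
  apply: (leq_trans su); rewrite addnA leq_add2r.
  have -> : (\sum_(i <- D) 4 * cX * i.2 = 2 * \sum_(i <- D) 2 * (cX * i.2))%N.
    by rewrite big_distrr /=; apply: eq_bigr => i _; rewrite !mulnA.
  move: tD; rewrite /t1 size_cat /word_inv size_rev size_map.
  by move: (size t) (size t0) (\sum_(i <- D) _)%N; clear; lia.
apply: (@le_trans _ _ ((4 * size t0)%N%:R + ((4 * cX)%N%:R * (7 * Y) + Y))); last first.
  have -> : E * Y = 4 * (Y / c) + ((4 * cX)%N%:R * (7 * Y) + Y).
    by rewrite /E natrM; field; rewrite gt_eqF.
  rewrite lerD2r natrM ler_wpM2l // ler_pdivlMr // mulrC //.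
apply: (@le_trans _ _ ((4 * size t0
    + (\sum_(i <- D) (4 * cX) * i.2 + flow_dist N x y))%N%:R `^ g)).
  by apply: ge0_ler_powR; rewrite ?nnegrE // ?(ltW g0) // ler_nat.
rewrite natrD; apply: (le_trans (powR_subadd _ _ g01)) => //; apply: lerD.
  exact: natr_powR_le.
rewrite natrD; apply: (le_trans (powR_subadd _ _ g01)) => //; apply: lerD; last first.
  by apply: le_trans fY; exact: natr_powR_le.
rewrite natr_sum; apply: (le_trans (powR_sum_le _ g01 _)) => //.
apply: (@le_trans _ _ ((4 * cX)%N%:R * \sum_(i <- D) i.2%:R `^ g)); last by rewrite ler_wpM2l.
rewrite mulr_sumr; apply: ler_sum => i _; rewrite natrM powRM //.
by rewrite ler_wpM2r ?powR_ge0 // natr_powR_le.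
Qed.

End WallsGrid.

(** * Walls on free solvable groups *)

Section SolvableWalls.
Variables (R : realType) (X : finType).
Local Notation D := (derived_nsubgroup (free_group X)).

Lemma derived_nsubgroup_commutators n : D n.+1 = subgroup_generated
  [set [~ x, y]%g | x in (D n : set _) & y in (D n : set _)]%classic :> set _.
Proof. by []. Qed.

Lemma derived_quotient0 (h k : quotient_group (D 0)) : h = k.
Proof. by rewrite -[h]word_ofK -[k]word_ofK; apply/cls_eqP. Qed.

(** The map [alpha / (1 + alpha)] sends the exponents below [1 / k] onto those below
    [1 / (k + 1)]. *)
Lemma solvable_walls (n : nat) (q alpha : R) : 0 < q ->
  0 < alpha < (n%:R + 1)^-1 -> has_walls (D n.+2) q alpha.
Proof.
move=> q0; elim: n alpha => [|n IH] alpha /andP[a0 a1].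
  apply: (walls_grid (derived_nsubgroup_commutators 1) (co := @coord X (D 0) (D 1))) => //.
  - by move=> h a s; exact: (coordM (derived_nsubgroup_commutators 0) derived_quotient0).
  - exact: (coord_route (derived_nsubgroup_commutators 0) derived_quotient0).
  - by rewrite a0; move: a1; rewrite add0r invr1.
  - exact: (coord_walls (derived_nsubgroup_commutators 0) derived_quotient0).
have n0 : 0 < n%:R + 1 :> R by rewrite ltr_wpDl.
have n1 : 0 < n.+1%:R + 1 :> R by rewrite ltr_wpDl.
have aS : alpha * (n%:R + 1 + 1) < 1.
  by move: a1; rewrite -[n.+1%:R]natr1 -div1r ltr_pdivlMr // -natr1.
have a1' : 0 < 1 - alpha by nra.
have -> : alpha = alpha / (1 - alpha) / (1 + alpha / (1 - alpha)).
  by field; rewrite subrK oner_neq0 gt_eqF.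
apply: (walls_step (derived_nsubgroup_commutators n.+2)); first by rewrite divr_gt0.
apply: IH; rewrite divr_gt0 //= ltr_pdivrMr // mulrC ltr_pdivlMr //.
nra.
Qed.

End SolvableWalls.

(** * Functions on the unit interval *)

Section Classes.
Variables (R : realType) (p : R) (p1 : 1 <= p).
Local Notation mu := (lebesgue01 R).
Local Notation T := (measurableTypeR R).

Lemma lebesgue01_setT : mu setT = 1%E.
Proof.
by rewrite /lebesgue01 /= /mrestr setTI lebesgue_measure_itv /= lte_fin ltr01 oppr0 adde0.
Qed.

Lemma Lnorm_ae (g h : T -> R) : measurable_fun setT g -> measurable_fun setT h ->
  ae_eq mu setT g h -> ('N[mu]_p%:E[EFin \o g] = 'N[mu]_p%:E[EFin \o h])%E.
Proof.
move=> mg mh gh; rewrite unlock; congr (_ `^ _)%E.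
have m (f : T -> R) : measurable_fun setT f ->
    measurable_fun setT (fun x => `|(EFin \o f) x| `^ p)%E.
  move=> mf; apply: (measurableT_comp (measurable_poweR p)).
  by apply: measurableT_comp => //; exact/measurable_EFinP.
apply: ge0_ae_eq_integral => //; try exact: m.
- by move=> x _; exact: poweR_ge0.
- by move=> x _; exact: poweR_ge0.
by apply: filterS gh => x /= gh xT; rewrite gh.
Qed.

Lemma Lp_class (g : T -> R) : measurable_fun setT g -> finite_norm mu p%:E g ->
  exists F : Lp01 p1, ae_eq mu setT (F : T -> R) g.
Proof.
move=> mg fg; pose gm : {mfun T >-> T} := @mfun_Sub _ _ T T g
  (mem_set (mg : measurable_fun setT (g : T -> T))).
pose q : {mfun_ mu, T >-> T} := \pi_({mfun_ mu, T >-> T})%qT gm.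
have qg : ae_eq mu setT (q : T -> R) g.
  have /eqmodP/asboolP : repr q = gm %[mod {mfun_ mu, T >-> T}] by rewrite reprK.
  exact.
have fq : finite_norm mu p%:E (q : T -> R).
  rewrite /finite_norm (@Lnorm_ae _ g) //; exact: (measurable_funPT (repr q)).
pose F : LspaceType mu (p1 : (1 <= p%:E)%E) := HB.pack q
  (isFinLebesgue.Build _ _ _ _ _ (p1 : (1 <= p%:E)%E) q fq).
by exists F.
Qed.

Lemma Lp_dist_ae (F G : Lp01 p1) (f g : T -> R) :
  measurable_fun setT f -> measurable_fun setT g ->
  ae_eq mu setT (F : T -> R) f -> ae_eq mu setT (G : T -> R) g ->
  Lp_dist F G = ('N[mu]_p%:E[EFin \o (f \- g)%R])%E.
Proof.
move=> mf mg Ff Gg; apply: Lnorm_ae; first apply: measurable_funB.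
  - exact: (measurable_funPT (repr (F : {mfun_ mu, T >-> T}))).
  - exact: (measurable_funPT (repr (G : {mfun_ mu, T >-> T}))).
 
  exact: measurable_funB.
by apply: filterS2 Ff Gg => x + + xT; move=> /(_ xT) /= -> /(_ xT) /= ->.
Qed.

End Classes.

(** The upper bound makes maps Lipschitz and the lower bound makes them compress. *)
Definition Lp_system (R : realType) (p q c : R)
    (e : nat -> measurableTypeR R -> R) : Prop :=
  (forall n, measurable_fun setT (e n)) /\
  forall (s : seq nat) (v : nat -> R), uniq s ->
    ('N[lebesgue01 R]_p%:E[EFin \o (fun x => \sum_(n <- s) v n * e n x)%R]
       <= (\sum_(n <- s) `|v n|)%:E)%E /\
    ((c * (\sum_(n <- s) `|v n| `^ q) `^ q^-1)%:E
       <= 'N[lebesgue01 R]_p%:E[EFin \o (fun x => \sum_(n <- s) v n * e n x)%R])%E.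

Section Bumps.
Variables (R : realType) (p : R).
Hypothesis p1 : 1 <= p.
Local Notation mu := (lebesgue01 R).
Local Notation T := (measurableTypeR R).

Lemma norm_sum_disjoint_powR (s : seq nat) (f : nat -> R) : uniq s ->
  (forall m n, f m != 0 -> f n != 0 -> m = n) ->
  `|\sum_(n <- s) f n| `^ p = \sum_(n <- s) `|f n| `^ p.
Proof.
have p0 : p != 0 by rewrite gt_eqF // (lt_le_trans ltr01).
move=> + f1; elim: s => [_|n s IH /= /andP[ns us]]; first by rewrite !big_nil normr0 powR0.
rewrite !big_cons; have [fn0|fn0] := eqVneq (f n) 0.
  by rewrite fn0 add0r normr0 powR0 // add0r IH.
have f0 m : m \in s -> f m = 0.
  move=> ms; apply/eqP; apply: contraNT ns => fm.
  by rewrite (f1 _ _ fn0 fm).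
rewrite !big_seq !big1 ?addr0 // => m /f0 -> //.
by rewrite normr0 powR0.
Qed.

Definition bump_itv n : set T := `](n.+2%:R)^-1, (n.+1%:R)^-1]%classic.
Definition bump_len n : R := (n.+1%:R)^-1 - (n.+2%:R)^-1.
(** The factor gives the function norm 1 in Lp. *)
Definition bump_fun n : T -> R := fun x => bump_len n `^ (- p^-1) * \1_(bump_itv n) x.

Lemma bump_len_gt0 n : 0 < bump_len n.
Proof. by rewrite subr_gt0 ltf_pV2 ?posrE // ltr_nat. Qed.

Lemma bump_itv_measure n : mu (bump_itv n) = (bump_len n)%:E.
Proof.
rewrite /lebesgue01 /= /mrestr setIidl.
  rewrite lebesgue_measure_itv /= lte_fin ltf_pV2 ?posrE // ltr_nat leqnn.
  by rewrite EFinN.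
move=> x; rewrite /bump_itv /= !in_itv /= => /andP[xl xu]; apply/andP; split.
  by apply: ltW; apply: lt_trans xl; rewrite invr_gt0.
by apply: (le_trans xu); rewrite invf_le1 // ler1n.
Qed.

Lemma bump_disjoint m n x : bump_itv m x -> bump_itv n x -> m = n.
Proof.
wlog mn : m n / (m <= n)%N.
  by move=> W; have /orP[mn|nm] := leq_total m n; [exact: W|move=> xm xn; apply/esym/W].
rewrite /bump_itv /= !in_itv /= => /andP[xm _] /andP[_ xn].
have := lt_le_trans xm xn; rewrite ltf_pV2 ?posrE // ltr_nat; lia.
Qed.

Lemma measurable_bump_itv n : measurable (bump_itv n).
Proof. exact: measurable_itv. Qed.

Lemma measurable_bump n : measurable_fun setT (bump_fun n).
Proof. by apply: measurable_funM => //; apply: measurable_indic; exact: measurable_bump_itv. Qed.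

Lemma bump_system : Lp_system p p 1 bump_fun.
Proof.
have p0 : 0 < p by rewrite (lt_le_trans ltr01).
split=> [n|s v us]; first exact: measurable_bump.
have hE x : `|\sum_(n <- s) v n * bump_fun n x| `^ p =
    \sum_(n <- s) (`|v n| `^ p / bump_len n) * \1_(bump_itv n) x.
  rewrite norm_sum_disjoint_powR // => [|m n].
    apply: eq_bigr => n _; rewrite /bump_fun indicE; case: (x \in bump_itv n) => /=; last first.
      by rewrite !mulr0 normr0 powR0 // gt_eqF.
    rewrite !mulr1 normrM powRM // (ger0_norm (powR_ge0 _ _)) -powRrM.
    by rewrite mulNr mulVf ?gt_eqF // powR_inv1 // ltW // bump_len_gt0.
  rewrite /bump_fun !indicE; case: (boolP (x \in bump_itv m)) => xm; last by rewrite !mulr0 eqxx.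
  case: (boolP (x \in bump_itv n)) => xn; last by rewrite !mulr0 eqxx.
  by move=> _ _; apply: bump_disjoint (set_mem xm) (set_mem xn).
have NE : ('N[mu]_p%:E[EFin \o (fun x => \sum_(n <- s) v n * bump_fun n x)%R]
    = ((\sum_(n <- s) `|v n| `^ p) `^ p^-1)%:E)%E.
  rewrite unlock -poweR_EFin; congr (_ `^ _)%E.
  transitivity (\int[mu]_x (\sum_(n <- s)
      (`|v n| `^ p / bump_len n)%:E * (\1_(bump_itv n) x)%:E))%E.
    by apply: eq_integral => x _; rewrite /= hE -sumEFin; apply: eq_bigr => n _.
  rewrite ge0_integral_sum //.
  - rewrite -sumEFin; apply: eq_bigr => n _.
    rewrite ge0_integralZl_EFin //.
    + rewrite integral_indic ?setIT //; last exact: measurable_bump_itv.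
      by rewrite bump_itv_measure -EFinM divfK // gt_eqF // bump_len_gt0.
    + by apply/measurable_EFinP; apply: measurable_indic; exact: measurable_bump_itv.
    + by rewrite divr_ge0 ?powR_ge0 // ltW // bump_len_gt0.
  - move=> n; apply/measurable_EFinP; apply: measurable_funM => //.
    by apply: measurable_indic; exact: measurable_bump_itv.
  - move=> n x _; rewrite lee_fin mulr_ge0 ?divr_ge0 ?powR_ge0 //.
    by rewrite ltW // bump_len_gt0.
rewrite NE; split; last by rewrite mul1r.
rewrite lee_fin; have p01 : 0 < p^-1 <= 1 by rewrite invr_gt0 p0 invf_le1.
apply: (le_trans (powR_sum_le _ p01 _)) => [n|]; first exact: powR_ge0.
apply: ler_sum => n _; rewrite -powRrM mulfV ?gt_eqF // powRr1 //.
Qed.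

End Bumps.

Lemma is_derive_bigsum (R : realType) (I : Type) (s : seq I) (f : I -> R -> R)
    (df : I -> R) (x : R) :
  (forall i, is_derive x 1 (f i) (df i)) ->
  is_derive x 1 (fun x => \sum_(i <- s) f i x) (\sum_(i <- s) df i).
Proof.
move=> fd; elim: s => [|i s IH].
  rewrite big_nil (_ : (fun _ => _) = cst 0); first exact: is_derive_cst.
  by apply/funext => y; rewrite big_nil.
rewrite big_cons (_ : (fun _ => _) = f i \+ (fun y => \sum_(j <- s) f j y)).
  exact: is_deriveD.
by apply/funext => y; rewrite big_cons.
Qed.

Section Cosines.
Variables (R : realType).
Local Notation mu := (lebesgue01 R).
Local Notation T := (measurableTypeR R).

Lemma integral_lebesgue01 (f : T -> \bar R) : measurable_fun setT f ->
  (forall x, 0 <= f x)%E ->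
  (\int[mu]_x f x = \int[lebesgue_measure]_(x in `[0%R, 1%R]) f x)%E.
Proof.
move=> mf f0; 
have mI : measurable ([set` `[0%R : R, 1%R]] : set T) by exact: measurable_itv.
have mN := measurableC mI.
rewrite [LHS](ge0_negligible_integral mN measurableT mf (fun x _ => f0 x)).
  rewrite setTD setCK; apply: eq_measure_integral => A _ A01.
  by rewrite /lebesgue01 /= /mrestr setIidl.
by rewrite /lebesgue01 /= /mrestr setICl measure0.
Qed.

Lemma is_derive_scale (c x df : R) (f : R -> R) :
  is_derive x 1 f df -> is_derive x 1 (fun y => c * f y) (c * df).
Proof.
move=> fd; have -> : (fun y => c * f y) = c \*: f by apply/funext.
by have -> : c * df = c *: df by []; exact: is_deriveZ.
Qed.

Lemma is_derive_add (x df dg : R) (f g : R -> R) :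
  is_derive x 1 f df -> is_derive x 1 g dg -> is_derive x 1 (fun y => f y + g y) (df + dg).
Proof. by move=> fd gd; exact: is_deriveD. Qed.

Lemma is_derive_mull (w x : R) : is_derive x 1 ( *%R w) w.
Proof.
rewrite -[w in X in is_derive _ _ _ X]mulr1; exact: is_derive_scale.
Qed.

(** The primitive of [cos (w * x)] that vanishes at the origin, including [w = 0]. *)
Definition cos_prim (w x : R) : R := if w == 0 then x else sin (w * x) / w.

Lemma is_derive_cos_prim (w x : R) : is_derive x 1 (cos_prim w) (cos (w * x)).
Proof.
rewrite /cos_prim; have [->|w0] := eqVneq w 0.
  by rewrite mul0r cos0; exact: is_derive_id.
rewrite (_ : (fun _ => _) = (fun y => w^-1 * (sin \o ( *%R w)) y)); last first.
  by apply/funext => y /=; rewrite mulrC.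
rewrite (_ : cos (w * x) = w^-1 * (cos (w * x) * w)); last by rewrite mulrCA mulVf ?mulr1.
exact: is_derive_scale (is_derive1_comp (is_derive_sin (w * x)) (is_derive_mull w x)).
Qed.

Lemma sin_pi_nat n : sin (pi * n%:R) = 0 :> R.
Proof.
elim: n => [|n IH]; first by rewrite mulr0 sin0.
by rewrite -natr1 mulrDr mulr1 sinDpi IH oppr0.
Qed.

Definition wave (n : nat) : T -> R := fun x => cos (pi * n.+1%:R * x).

Lemma wave_mul m n x : wave m x * wave n x =
  2^-1 * (cos ((pi * m.+1%:R - pi * n.+1%:R) * x) + cos ((pi * m.+1%:R + pi * n.+1%:R) * x)).
Proof. by rewrite /wave mulrBl (mulrDl (pi * _) (pi * _)) cosB cosD; field. Qed.

Lemma is_derive_wave n (x : R) :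
  is_derive x 1 (wave n) (- sin (pi * n.+1%:R * x) * (pi * n.+1%:R)).
Proof. exact: is_derive1_comp (is_derive_cos _) (is_derive_mull _ _). Qed.

Definition wave_sum (s : seq nat) (v : nat -> R) : T -> R := fun x => \sum_(n <- s) v n * wave n x.

Lemma is_derive_wave_sum s v (x : R) : exists dx, is_derive x 1 (wave_sum s v) dx.
Proof.
eexists; apply: is_derive_bigsum => n; apply: (is_derive_scale (v n)); exact: is_derive_wave.
Qed.

Lemma continuous_wave_sum s v : continuous (wave_sum s v : R -> R).
Proof.
move=> x; have [dx [dh _]] := is_derive_wave_sum s v x.
exact/differentiable_continuous/derivable1_diffP.
Qed.

Lemma measurable_wave_sum s v : measurable_fun setT (wave_sum s v).
Proof. by apply: continuous_measurable_fun; exact: continuous_wave_sum. Qed.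

Lemma measurable_wave n : measurable_fun setT (wave n).
Proof.
have -> : wave n = wave_sum [:: n] (fun=> 1).
  by apply/funext => x; rewrite /wave_sum big_seq1 mul1r.
exact: measurable_wave_sum.
Qed.

Lemma cos_prim0 w : cos_prim w 0 = 0.
Proof. by rewrite /cos_prim mulr0 sin0 mul0r; case: ifP. Qed.

Lemma cos_prim1 m n : cos_prim (pi * m.+1%:R - pi * n.+1%:R) 1 +
   cos_prim (pi * m.+1%:R + pi * n.+1%:R) 1 = (m == n)%:R.
Proof.
rewrite /cos_prim -mulrBr -mulrDr -natrD !mulr1 sin_pi_nat mul0r.
rewrite !mulf_eq0 !(gt_eqF (pi_gt0 R)) /= pnatr_eq0 addr0 subr_eq0 eqr_nat eqSS.
case: eqP => // _; have [mn|/ltnW nm] := leqP n m.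
  by rewrite -natrB ?ltnS // sin_pi_nat mul0r.
by rewrite -opprB mulrN sinN -natrB ?ltnS // sin_pi_nat oppr0 mul0r.
Qed.

(** The cosines are orthogonal. Since a product of two of them is a sum of cosines,
    the square of a combination has an explicit primitive, and one application of
    the fundamental theorem of calculus gives all the products at once. *)
Lemma integral_wave_sum_sqr s v : uniq s ->
  (\int[mu]_x ((wave_sum s v x) ^+ 2)%:E = ((\sum_(n <- s) v n ^+ 2) / 2)%:E)%E.
Proof.
move=> us; rewrite integral_lebesgue01; last 2 first.
- apply/measurable_EFinP; apply: measurable_funX; exact: measurable_wave_sum.
- by move=> x; rewrite lee_fin sqr_ge0.
pose P m n (x : R) := v m * v n * (2^-1 * (cos_prim (pi * m.+1%:R - pi * n.+1%:R) x
   + cos_prim (pi * m.+1%:R + pi * n.+1%:R) x)).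
pose F (x : R) := \sum_(m <- s) \sum_(n <- s) P m n x.
have dP m n (x : R) : is_derive x 1 (P m n) (v m * wave m x * (v n * wave n x)).
  rewrite mulrACA wave_mul; apply: is_derive_scale; apply: is_derive_scale.
  by apply: is_derive_add; exact: is_derive_cos_prim.
have dF (x : R) : is_derive x 1 F (wave_sum s v x ^+ 2).
  rewrite expr2 /wave_sum big_distrl /=; apply: is_derive_bigsum => m.
  by rewrite big_distrr /=; apply: is_derive_bigsum => n; exact: dP.
have cF : continuous F.
  by move=> x; have [df _] := dF x; exact/differentiable_continuous/derivable1_diffP.
rewrite (@continuous_FTC2 _ (fun x : R => wave_sum s v x ^+ 2) F 0 1) //.
- have -> : F 0 = 0.
    by rewrite /F big1 // => m _; rewrite big1 // => n _; rewrite /P !cos_prim0 addr0 !mulr0.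
  rewrite sube0; congr EFin; rewrite /F mulr_suml big_seq [RHS]big_seq.
  apply: eq_bigr => m ms; rewrite (bigD1_seq m) //= big1 ?addr0.
    by rewrite /P cos_prim1 eqxx mulr1 expr2.
  by move=> n nm; rewrite /P cos_prim1 eq_sym (negbTE nm) !mulr0.
- apply: continuous_subspaceT => x; apply: cvgM; exact: continuous_wave_sum.
- split.
  + by move=> x _; have [df _] := dF x.
  + by apply: cvg_at_right_filter; exact: cF.
  + by apply: cvg_at_left_filter; exact: cF.
- by move=> x _; rewrite derive1E; have [_ ->] := dF x.
Qed.

(** The upper bound holds because the waves are bounded by 1. For the lower bound,
    the L2 norm is given by orthogonality, and Hoelder's inequality against the
    constant 1 bounds it by the Lp norm. *)
Lemma wave_system p : 2 < p -> Lp_system p 2 (2^-1 `^ 2^-1) wave.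
Proof.
move=> p2; have p0 : 0 < p by rewrite (lt_trans _ p2).
split=> [n|s v us]; first exact: measurable_wave.
rewrite -/(wave_sum s v); set h := wave_sum s v.
have mh : measurable_fun setT h by exact: measurable_wave_sum.
have hV x : `|h x| <= \sum_(n <- s) `|v n|.
  rewrite /h /wave_sum; apply: (le_trans (ler_norm_sum _ _ _)); apply: ler_sum => n _.
  by rewrite normrM ler_piMr // ler_norml cos_geN1 cos_le1.
have mhp : measurable_fun setT (fun x => (`|h x| `^ p)%:E).
  apply/measurable_EFinP; apply: (measurableT_comp (measurable_powR p)).
  exact: measurableT_comp.
split.
  set V := \sum_(n <- s) _ in hV *; have V0 : 0 <= V by exact: sumr_ge0.
  have -> : V = (V `^ p) `^ p^-1 by rewrite -powRrM mulfV ?gt_eqF // powRr1.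
  rewrite unlock -poweR_EFin; apply: gt0_ler_poweR.
  - by rewrite invr_ge0 ltW.
  - by rewrite in_itv /= leey andbT; apply: integral_ge0 => x _; rewrite lee_fin powR_ge0.
  - by rewrite in_itv /= leey andbT lee_fin powR_ge0.
  apply: (@le_trans _ _ (\int[mu]_x (cst (V `^ p)%:E x))%E).
    apply: ge0_le_integral => //=.
    move=> x _; rewrite lee_fin ge0_ler_powR // ?nnegrE // ltW //.
  by rewrite integral_cst // lebesgue01_setT mule1.
pose r := p / 2; pose r' := (1 - r^-1)^-1.
have r1 : 1 < r by rewrite /r ltr_pdivlMr // mul1r.
have r0 : 0 < r by rewrite (lt_trans ltr01).
have r'0 : 0 < r' by rewrite invr_gt0 subr_gt0 invf_lt1.
have rr' : r^-1 + r'^-1 = 1 by rewrite /r' invrK subrKC.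
have := @hoelder _ T R mu (fun x => h x ^+ 2) (cst 1) r r'
  (measurable_funX 2 mh) (@measurable_cst _ _ _ _ _ _) r0 r'0 rr'.
set Z := (\int[mu]_x (`|h x| `^ p)%:E)%E.
have Z0 : (0 <= Z)%E by apply: integral_ge0 => x _; rewrite lee_fin powR_ge0.
have -> : ('N[mu]_r%:E[EFin \o (fun x => h x ^+ 2)%R] = Z `^ r^-1)%E.
  rewrite unlock; congr (_ `^ _)%E; apply: eq_integral => x _ /=.
  rewrite normrX -powR_mulrn // -powRrM /r; congr (_ `^ _)%:E.
  by rewrite mulrCA mulfV ?mulr1.
have -> : ('N[mu]_r'%:E[EFin \o (cst 1)%R] = 1)%E.
  by rewrite -[EFin \o cst 1%R]/(cst 1%E) Lnorm_cst1 lebesgue01_setT poweR_EFin powR1.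
have -> : ('N[mu]_1[EFin \o ((fun x => h x ^+ 2) \* cst 1)%R] =
    ((\sum_(n <- s) v n ^+ 2) / 2)%:E)%E.
  rewrite Lnorm1 -integral_wave_sum_sqr //; apply: eq_integral => x _ /=.
  by rewrite mulr1 ger0_norm // sqr_ge0.
rewrite mule1 => AZ.
have -> : ('N[mu]_p%:E[EFin \o h] = (Z `^ r^-1) `^ 2^-1)%E.
  rewrite -poweRrM unlock; congr (_ `^ _)%E.
  by rewrite /r invf_div -mulrA mulrC -mulrA mulVf ?mulr1.
rewrite -powRM ?invr_ge0 //; last by apply: sumr_ge0 => n _; exact: powR_ge0.
rewrite -poweR_EFin; apply: gt0_ler_poweR;
  rewrite ?in_itv /= ?leey ?andbT ?lee_fin ?invr_ge0 ?poweR_ge0 //.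
  by rewrite mulr_ge0 ?invr_ge0 // sumr_ge0 // => n _; exact: powR_ge0.
rewrite mulrC; move: AZ; congr (_ <= _)%E; congr (_ / _)%:E.
by apply: eq_bigr => n _; rewrite powR_mulrn // real_normK ?num_real.
Qed.

End Cosines.

(** * From walls to compression *)

Section WordMetric.
Variables (G : groupType) (S : seq G).
Hypothesis hS : generates S.
Implicit Types (g h : G).

Lemma expressibleM g h m n : expressible S g m -> expressible S h n ->
  expressible S (g * h)%g (m + n).
Proof.
move=> [u [<- uS <-]] [v [<- vS <-]]; exists (u ++ v); split.
- by rewrite size_cat.
- by move=> s; rewrite mem_cat => /orP[/uS|/vS].
- by rewrite big_cat.
Qed.

Lemma expressibleV g n : expressible S g n -> expressible S g^-1%g n.
Proof.
move=> [u [<- uS <-]]; exists (rev (map (fun s => s^-1)%g u)); split.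
- by rewrite size_rev size_map.
- by move=> s; rewrite mem_rev => /mapP[s' /uS s'S ->]; rewrite invgK orbC.
- elim: u {uS} => [|s u IH]; first by rewrite !big_nil invg1.
  by rewrite /= rev_cons -cats1 big_cat big_seq1 big_cons invgM; rewrite -IH.
Qed.

Lemma expressible1 : expressible S 1%g 0.
Proof. by exists [::]; rewrite big_nil. Qed.

Lemma expressible_ex g : exists n, expressible S g n.
Proof.
have : (subgroup_generated [set` S] `<=` [set g | exists n, expressible S g n])%classic.
  apply: smallest_sub => [|s sS /=].
    apply/is_subgroupP; split; first by exists 0%N; exact: expressible1.
    by move=> x y [m xm] [n yn]; exists (m + n)%N; apply: expressibleM => //; exact: expressibleV.
  exists 1%N, [:: s]; split=> //; last by rewrite big_seq1.
  by move=> s'; rewrite inE => /eqP ->; apply/orP; left.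
by rewrite hS; apply.
Qed.

Lemma word_lengthP g : expressible S g (word_length S g) /\
  forall m, expressible S g m -> (word_length S g <= m)%N.
Proof.
apply: (@getPex _ [set n | expressible S g n /\
  forall m, expressible S g m -> (n <= m)%N]%classic).
have [n0 en0] := expressible_ex g.
have ex : exists n, `[< expressible S g n >] by exists n0; exact/asboolP.
exists (ex_minn ex); case: ex_minnP => n /asboolP en nmin; split=> // m em.
by apply: nmin; exact/asboolP.
Qed.

Lemma word_lengthM g h : (word_length S (g * h)%g <= word_length S g + word_length S h)%N.
Proof.
have [_] := word_lengthP (g * h)%g; apply.
by apply: expressibleM; have [] := word_lengthP g; have [] := word_lengthP h.
Qed.

Lemma word_length1 : word_length S 1%g = 0%N.
Proof. by apply/eqP; rewrite -leqn0; have [_] := word_lengthP 1%g; apply; exact: expressible1. Qed.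

End WordMetric.

Section CompareLengths.
Variables (X : finType) (N : normal_subgroup (free_group X)).
Local Notation G := (quotient_group N).
Variable S : seq G.
Hypothesis hS : generates S.

Lemma word_length_le_size : exists m, forall t, (word_length S (cls N t) <= m * size t)%N.
Proof.
exists (\max_(a : X * bool) word_length S (cls N [:: a])); elim=> [|a t IH].
  by rewrite cls_nil word_length1.
rewrite cls_cons mulnS; apply: (leq_trans (word_lengthM hS _ _)); apply: leq_add => //.
exact: (leq_bigmax (a : X * bool)).
Qed.

Lemma size_le_word_length :
  exists m, forall g, exists2 t, cls N t = g & (size t <= m * word_length S g)%N.
Proof.
pose m := \max_(s <- S) size (word_of s); exists m => g.
have mP s : s \in S -> (size (word_of s) <= m)%N.
  by move=> sS; apply: (@leq_bigmax_seq _ S xpredT (fun s : G => size (word_of s)) s).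
have [[w [<- wS <-]] _] := word_lengthP hS g.
elim: w wS => [|s w IH] wS; first by exists [::]; rewrite ?big_nil.
have [|t tw tm] := IH; first by move=> s' s'w; apply: wS; rewrite inE s'w orbT.
have [u us um] : exists2 u, cls N u = s & (size u <= m)%N.
  have /orP[sS|sS] := wS s (mem_head _ _).
    by exists (word_of s); [rewrite word_ofK|exact: mP].
  exists (word_inv (word_of s^-1%g)); first by rewrite cls_inv word_ofK invgK.
  by rewrite /word_inv size_rev size_map; exact: mP.
exists (u ++ t); first by rewrite cls_cat us tw big_cons.
by rewrite size_cat /= mulnS leq_add.
Qed.

Variables (R : realType) (I : choiceType) (w : I -> R) (A : G -> {fset I}).
Hypothesis w0 : forall i, 0 <= w i.

Lemma walls_lipschitz K :
  (forall h a, \sum_(i <- symd (A h) (A (h * cls N [:: a])%g)) w i <= K) ->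
  forall t x, \sum_(i <- symd (A x) (A (x * cls N t)%g)) w i <= K * (size t)%:R.
Proof.
move=> HK; elim=> [|a t IH] x.
  rewrite cls_nil mulg1 mulr0 big_seq big1 // => i; by rewrite mem_symd eqxx.
rewrite /= -natr1 mulrDr mulr1 addrC cls_cons mulgA.
apply: le_trans (lerD (HK x a) (IH (x * cls N [:: a])%g)).
rewrite -big_cat; apply: ler_sum_subset => //; exact: symd_triangle.
Qed.

(** The group is countable: a wall is coded by the first word in whose wall set it
    appears, together with its rank in that set. *)
Lemma walls_codes : exists code : I -> nat, forall x y i j, i \in A x -> j \in A y ->
  code i = code j -> i = j.
Proof.
pose dec (n : nat) : seq (X * bool) := odflt [::] (choice.unpickle n).
pose B n := A (cls N (dec n)).
have BP x i : i \in A x -> exists n, i \in B n.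
  move=> ix; exists (choice.pickle (word_of x : seq (X * bool))).
  by rewrite /B /dec choice.pickleK /= word_ofK.
pose num i := if pselect (exists n, i \in B n) is left ex then ex_minn ex else 0%N.
have numP x i : i \in A x -> i \in B (num i).
  by move=> /BP ex; rewrite /num; case: pselect => // ex'; case: ex_minnP.
exists (fun i => choice.pickle (num i, index i (B (num i)))) => x y i j ix jy.
move=> /(pcan_inj choice.pickleK)[nij]; rewrite nij => ij.
have iB : i \in B (num j) by rewrite -nij (numP x).
by rewrite -[LHS](nth_index i iB) ij nth_index // (numP y).
Qed.

End CompareLengths.

Lemma sum_symd_sign (R : comRingType) (I : choiceType) (A B : {fset I}) (F : I -> R) :
  \sum_(i <- A) F i - \sum_(i <- B) F i =
  \sum_(i <- symd A B) (if i \in A then F i else - F i).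
Proof.
have pe (P Q : pred I) (s1 s2 : {fset I}) (f : I -> R) :
    (forall i, (i \in s1) && P i = (i \in s2) && Q i) ->
    \sum_(i <- s1 | P i) f i = \sum_(i <- s2 | Q i) f i.
  move=> PQ; rewrite -[LHS]big_filter -[RHS]big_filter; apply: perm_big; apply: uniq_perm.
  - by rewrite filter_uniq // fset_uniq.
  - by rewrite filter_uniq // fset_uniq.
  - by move=> i; rewrite !mem_filter andbC PQ andbC.
rewrite (bigID [in B] xpredT F) (bigID [in A] xpredT F) [RHS](bigID [in A]) /=.
have -> : \sum_(i <- A | i \in B) F i = \sum_(i <- B | i \in A) F i.
  by apply: pe => i; rewrite andbC.
have -> : \sum_(i <- symd A B | i \in A) (if i \in A then F i else - F i) =
    \sum_(i <- A | i \notin B) F i.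
  rewrite (eq_bigr F) => [|i ->//]; apply: pe => i; rewrite mem_symd.
  by case: (i \in A); case: (i \in B).
have -> : \sum_(i <- symd A B | i \notin A) (if i \in A then F i else - F i) =
    - \sum_(i <- B | i \notin A) F i.
  rewrite -sumrN (eq_bigr (fun i => - F i)) => [|i /negbTE ->//]; apply: pe => i.
  by rewrite mem_symd; case: (i \in A); case: (i \in B).
by ring.
Qed.

Lemma Lp_system_reindex (R : realType) (p q c : R) e (I : eqType)
    (code : I -> nat) (s : seq I) (v : I -> R) :
  Lp_system p q c e -> uniq s -> {in s &, injective code} ->
  ('N[lebesgue01 R]_p%:E[EFin \o (fun x => \sum_(i <- s) v i * e (code i) x)%R]
       <= (\sum_(i <- s) `|v i|)%:E)%E /\
    ((c * (\sum_(i <- s) `|v i| `^ q) `^ q^-1)%:E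
       <= 'N[lebesgue01 R]_p%:E[EFin \o (fun x => \sum_(i <- s) v i * e (code i) x)%R])%E.
Proof.
move=> [_ sys] us inj.
pose v' n := \sum_(i <- s | code i == n) v i.
have v'E i : i \in s -> v' (code i) = v i.
  move=> si; rewrite /v' big_mkcond (bigD1_seq i) //= eqxx big1_seq ?addr0 // => j.
  move=> /andP[ji js]; case: eqP => // ij.
  by move: ji; rewrite (inj _ _ js si ij) eqxx.
have us' : uniq (map code s) by rewrite map_inj_in_uniq.
have := sys _ v' us'; rewrite !big_map.
have -> : (fun x => \sum_(n <- map code s) v' n * e n x) =
   (fun x => \sum_(i <- s) v i * e (code i) x).
  by apply/funext => x; rewrite big_map big_seq [RHS]big_seq; apply: eq_bigr => i /v'E ->.
have -> : \sum_(i <- s) `|v' (code i)| = \sum_(i <- s) `|v i|.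
  by rewrite big_seq [RHS]big_seq; apply: eq_bigr => i /v'E ->.
have -> // : \sum_(i <- s) `|v' (code i)| `^ q = \sum_(i <- s) `|v i| `^ q.
by rewrite big_seq [RHS]big_seq; apply: eq_bigr => i /v'E ->.
Qed.
Section Compression.
Variables (R : realType) (X : finType) (N : normal_subgroup (free_group X)).
Local Notation G := (quotient_group N).
Variables (S : seq G) (p : R) (hp : 1 <= p).
Hypothesis hS : generates S.

(** The signed sum over the symmetric difference of two wall sets is the difference
    of the images, so the two bounds on combinations apply to it. *)
Lemma walls_compression (q alpha c0 : R) e : 0 < q -> 0 < alpha -> 0 < c0 ->
  Lp_system p q c0 e -> has_walls N q alpha ->
  ((alpha / q)%:E <= Lp_compression_exponent hp S)%E.
Proof.
move=> q0 a0 c00 sys [I [w [A [w0 [K HK] [c c1 low]]]]].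
have [code codeP] := walls_codes A.
pose g x : measurableTypeR R -> R := fun z => \sum_(i <- A x) w i * e (code i) z.
have mg x : measurable_fun setT (g x).
  apply: measurable_sum => i; apply: measurable_funM => //; exact: sys.1.
have codeA x : {in A x &, injective code} by move=> i j; exact: codeP.
have fg x : finite_norm (lebesgue01 R) p%:E (g x).
  have [le _] := Lp_system_reindex w sys (fset_uniq (A x)) (codeA x).
  by apply: le_lt_trans le _; rewrite ltry.
have /choice[f fE] x := Lp_class hp (mg x) (fg x).
have distE x y : let D := symd (A x) (A y) in
    (Lp_dist (f x) (f y) <= (\sum_(i <- D) w i)%:E)%E /\
    ((c0 * (\sum_(i <- D) w i `^ q) `^ q^-1)%:E <= Lp_dist (f x) (f y))%E.
  move=> D; rewrite (Lp_dist_ae (mg x) (mg y) (fE x) (fE y)).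
  pose v i := if i \in A x then w i else - w i.
  have -> : (g x \- g y) = (fun z => \sum_(i <- D) v i * e (code i) z).
    apply/funext => z; rewrite /g /= sum_symd_sign; apply: eq_bigr => i _.
    by rewrite /v; case: ifP => // _; rewrite mulNr.
  have vE i : `|v i| = w i by rewrite /v; case: ifP; rewrite ?normrN ger0_norm.
  have DA i : i \in D -> exists z, i \in A z.
    by rewrite mem_symd; case ix: (i \in A x); case iy: (i \in A y) => // _; [exists x|exists y].
  have := Lp_system_reindex v sys (fset_uniq D) _.
  have -> : \sum_(i <- D) `|v i| = \sum_(i <- D) w i by apply: eq_bigr => i _.
  have -> : \sum_(i <- D) `|v i| `^ q = \sum_(i <- D) w i `^ q.
    by apply: eq_bigr => i _; rewrite vE.
  by apply=> i j /DA[z iz] /DA[z' jz']; exact: codeP iz jz'.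
apply: ereal_sup_ubound; exists (alpha / q) => //; split; first by rewrite divr_ge0 // ltW.
exists f; split.
  have [m mP] := size_le_word_length hS.
  (* [K] could be negative if there are no letters. *)
  exists (Num.max K 0 * m%:R) => x y.
  have [t tE tm] := mP (x^-1 * y)%g.
  have := walls_lipschitz w0 HK t x; rewrite tE mulVKg => wK.
  apply: (le_trans (distE x y).1); rewrite lee_fin; apply: (le_trans wK).
  rewrite -mulrA -natrM; apply: (@le_trans _ _ (Num.max K 0 * (size t)%:R)).
    by rewrite ler_wpM2r // le_max lexx.
  by rewrite ler_wpM2l ?ler_nat // le_max lexx orbT.
have [m mP] := word_length_le_size hS.
have mS0 : 0 < m.+1%:R `^ (alpha / q) :> R by rewrite powR_gt0.
exists (c0 * c `^ q^-1 / m.+1%:R `^ (alpha / q)).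
  by rewrite divr_gt0 // mulr_gt0 // powR_gt0.
move=> x y _; apply: le_trans (distE x y).2; rewrite lee_fin -!mulrA ler_wpM2l ?(ltW c00) //.
have [t tE ct] := low x y.
have wt : (word_dist S x y)%:R <= m.+1%:R * (size t)%:R :> R.
  rewrite /word_dist -tE mulKg -natrM ler_nat; apply: (leq_trans (mP t)).
  by rewrite leq_mul2r leqnSn orbT.
apply: (@le_trans _ _ (c `^ q^-1 * (size t)%:R `^ (alpha / q))).
  rewrite ler_wpM2l ?powR_ge0 // ler_pdivrMl // -powRM //.
  by apply: ge0_ler_powR; rewrite ?nnegrE ?divr_ge0 ?mulr_ge0 ?(ltW a0) ?(ltW q0).
rewrite powRrM -powRM ?powR_ge0 ?(ltW c1) //.
apply: ge0_ler_powR; rewrite ?nnegrE ?invr_ge0 ?(ltW q0) //.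
- by rewrite mulr_ge0 ?powR_ge0 // ltW.
- by apply: sumr_ge0 => i _; exact: powR_ge0.
Qed.

End Compression.

Theorem theorem2 (R : realType) (r d : nat) (p : R)
    (hr : (2 <= r)%N) (hd : (2 <= d)%N) (hp : 1 <= p)
    (S : seq (free_solvable r d)) (hS : generates S) :
  ((1 / (d%:R - 1) * Num.max (1 / p) (1 / 2))%:E
     <= Lp_compression_exponent hp S)%E.
Proof.
have p0 : 0 < p by rewrite (lt_le_trans ltr01).
case: d hd S hS => [//|[//|n]] _ S hS.
(* Here [q] is the smaller of [p] and 2. *)
have [q [c0 [e [q0 c00 sys ->]]]] : exists q c0 e,
    [/\ 0 < q, 0 < c0, Lp_system p q c0 e & Num.max (1 / p) (1 / 2) = 1 / q].
  have [p2|p2] := leP p 2.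
    exists p, 1, (@bump_fun R p); split=> //; first exact: bump_system.
    by apply/max_idPl; rewrite !div1r lef_pV2 ?posrE.
  exists 2, (2^-1 `^ 2^-1), (@wave R); split=> //; first exact: wave_system.
  by apply/max_idPr; rewrite !div1r lef_pV2 ?posrE // ltW.
have -> : 1 / (n.+2%:R - 1) = (n%:R + 1)^-1 :> R.
  by rewrite div1r -!natr1 addrK.
set T := (n%:R + 1)^-1; have T0 : 0 < T by rewrite invr_gt0 ltr_wpDl.
apply/lee_addgt0Pr => eps eps0.
(* An exponent in the range of [solvable_walls] that loses at most [eps] after
   division by [q]. *)
pose alpha := Num.max (T / 2) (T - eps * q).
have a0 : 0 < alpha by rewrite lt_max divr_gt0.
have aT : alpha < T.
  rewrite gt_max; apply/andP; split; first by rewrite ltr_pdivrMr // mulr_natr mulr2n ltrDl.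
  by rewrite ltrBlDr ltrDl mulr_gt0.
have W : has_walls (derived_nsubgroup (free_group 'I_r) n.+2) q alpha.
  by apply: solvable_walls => //; rewrite a0.
apply: le_trans (leeD2r _ (walls_compression hp hS q0 a0 c00 sys W)).
rewrite -EFinD lee_fin div1r -lerBlDr -[X in _ - X](mulfK (lt0r_neq0 q0)) -mulrBl.
by rewrite ler_wpM2r ?invr_ge0 ?(ltW q0) // le_max lexx orbT.
Qed.
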